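(* Let $c>0$, let $E\subset\mathbb{R}^n$ be compact, and let $u$ be the maximal viscosity solution of $$u_t-\left(\operatorname{div}\left(\frac{Du}{|Du|}\right)+1\right)|Du|=c\,\mathbf{1}_E\ \text{ in }\mathbb{R}^n\times(0,\infty),\qquad u(\cdot,0)=0\ \text{ on }\mathbb{R}^n .$$ Assume that $\mathcal{F}^+[E](t)\to\mathbb{R}^n$ as $t\to\infty$. For $R\ge n$ and $t\geq 0$ set $U_R(t):=\inf\{u_*(x,t): x\in\overline{B}(0,R)\cup E\}$. Then for each $R\ge n$ there exist $a_R>0$ and $t_1>0$ such that $$U_R(t)\ge a_R(t-t_1)\quad\text{for all }t\ge0 .$$ Thus, $$\liminf_{t\to\infty}\left(\inf_{x\in B(0,R)}\frac{u_*(x,t)}{t}\right)\ge a_R .$$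
   Context: $B(x,R)$ is the open ball of radius $R$ centered at $x$, $\overline{B}(x,R)$ its closure; $\mathbf{1}_E$ is the indicator function of $E$; $u_*$ is the lower semicontinuous envelope of $u$. Front with obstacle. For a closed set $A\subset\mathbb{R}^n$, $\mathcal{F}^+[A](t)$ denotes the solution at time $t$ of the front propagation problem $V=\kappa+1$ (outer normal velocity $V$, mean curvature $\kappa$ in the direction of the outer normal, negative for balls) started from $A$ with obstacle $A$, i.e. subject to $\operatorname{int}A\subset\mathcal{F}^+[A](t)$ for all $t\ge0$. It is understood in the level-set sense: with $\psi_A(x)=\max\{-1,\min\{1,\operatorname{dist}(x,\mathbb{R}^n\setminus A)-\operatorname{dist}(x,A)\}\}$ (distance to the empty set being $+\infty$; so $\{\psi_A>0\}=\operatorname{int}A$) and $v$ the bounded continuous viscosity solution of $\min\{v_t-(\operatorname{div}(Dv/|Dv|)+1)|Dv|,\ v-\psi_A\}=0$ in $\mathbb{R}^n\times(0,\infty)$, $v(\cdot,0)=\psi_A$ (with the operator replaced by its lower/upper semicontinuous envelope at $Dv=0$ for sub/supersolutions), $\mathcal{F}^+[A](t)=\{x: v(x,t)>0\}$ for $t>0$. The convergence $\mathcal{F}^+[E](t)\to\mathbb{R}^n$ means that every compact set is contained in $\mathcal{F}^+[E](t)$ for all sufficiently large $t$. Viscosity solutions. Let $\mathbb{S}^n$ be the real symmetric $n\times n$ matrices. For $p\in\mathbb{R}^n\setminus\{0\}$, $X\in\mathbb{S}^n$ put $\sigma(p)=I-(p\otimes p)/|p|^2$ and $H(p,X)=-\operatorname{tr}[\sigma(p)X]-|p|$;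 $H_*$, $H^*$ denote the lower and upper semicontinuous envelopes of $H$ on $\mathbb{R}^n\times\mathbb{S}^n$. In general $h^*$, $h_*$ denote the upper and lower semicontinuous envelopes of a locally bounded function $h$. For a locally bounded right-hand side $f:\mathbb{R}^n\to\mathbb{R}$ and continuous initial datum $u_0$, a locally bounded $u:\mathbb{R}^n\times[0,\infty)\to\mathbb{R}$ is a viscosity subsolution of $u_t-(\operatorname{div}(Du/|Du|)+1)|Du|=f(x)$, $u(\cdot,0)=u_0$, if $u^*(\cdot,0)\le u_0$ and $\tau+H_*(p,X)\le f^*(x_0)$ for all $(x_0,t_0)\in\mathbb{R}^n\times(0,\infty)$ and $(p,X,\tau)\in J^+u^*(x_0,t_0)$; it is a viscosity supersolution if $u_*(\cdot,0)\ge u_0$ and $\tau+H^*(p,X)\ge f_*(x_0)$ for all $(x_0,t_0)\in\mathbb{R}^n\times(0,\infty)$ and $(p,X,\tau)\in J^-u_*(x_0,t_0)$; it is a viscosity solution if it is both. Here $J^\pm$ are the parabolic super/sub semijets: $(p,X,\tau)\in J^+v(x_0,t_0)$ iff $v(x,t)\le v(x_0,t_0)+\tau(t-t_0)+p\cdot(x-x_0)+\frac12X(x-x_0)\cdot(x-x_0)+o(|t-t_0|+|x-x_0|^2)$ as $(x,t)\to(x_0,t_0)$, and $J^-v=-J^+(-v)$. A function $u$ is called compactly supported in space if for every $T>0$ there is $R_T>0$ with $u(x,t)=0$ for $x\notin B(0,R_T)$, $t\in[0,T]$. The maximal viscosity solution is the viscosity solution $u$, compactly supported in space, such that $u\ge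 v$ on $\mathbb{R}^n\times[0,\infty)$ for every viscosity solution $v$ compactly supported in space. *)

(* Defs.v *)
From HB Require Import structures.
From mathcomp Require Import all_boot all_order all_algebra.
From mathcomp Require Import all_classical all_reals all_analysis.

Set Implicit Arguments.
Unset Strict Implicit.
Unset Printing Implicit Defensive.

Import Order.TTheory GRing.Theory Num.Theory.
Import numFieldNormedType.Exports.

Local Open Scope classical_set_scope.
Local Open Scope ring_scope.

(* Points of R^n are row vectors. The norm of the library on 'rV[R]_n is the
   sup norm, hence the Euclidean one below; both give the same topology. *)
Section Euclidean.
Context {R : realType} {n : nat}.
Implicit Types (x y p : 'rV[R]_n) (A : set 'rV[R]_n).

Definition dotv x y : R := (x *m y^T) 0 0.

Definition enorm x : R := Num.sqrt (dotv x x).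

Definition eball x (r : R) : set 'rV[R]_n := [set y | enorm (y - x) < r].

(* dist(x, set0) = +oo *)
Definition edistance x A : \bar R :=
  ereal_inf [set (enorm (x - y))%:E | y in A].

End Euclidean.

(* Semicontinuous envelopes, at any point of the closure of D, of a function
   which only matters on D. The neighbourhoods are not punctured, so at points
   of D the value of the function is taken into account. *)
Section Envelopes.
Context {R : realType} {X : topologicalType}.
Implicit Types (D : set X) (f : X -> R).

Definition usc_env D f (z : X) : \bar R :=
  limf_esup (EFin \o f) (within D (nbhs z)).

Definition lsc_env D f (z : X) : \bar R :=
  limf_einf (EFin \o f) (within D (nbhs z)).

Definition locally_bounded D f : Prop :=
  forall z, D z -> bounded_near f (within D (nbhs z)).

End Envelopes.

Section Equation.
Context {R : realType} {n : nat}.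
Local Notation V := 'rV[R]_n.

(* R^n x [0, +oo); functions on it are represented by functions on V * R whose
   values at negative times are irrelevant. *)
Definition spacetime : set (V * R) := [set z | 0 <= z.2].

(* p is a row vector, so p^T *m p is the matrix of p (x) p *)
Definition sigma (p : V) : 'M[R]_n := 1%:M - (enorm p ^- 2) *: (p^T *m p).

Definition Hfun (q : V * 'M[R]_n) : R := - \tr (sigma q.1 *m q.2) - enorm q.1.

Definition Hdom : set (V * 'M[R]_n) := [set q | q.1 != 0 /\ q.2^T = q.2].

Definition Hlow (p : V) (X : 'M[R]_n) : \bar R := lsc_env Hdom Hfun (p, X).
Definition Hupp (p : V) (X : 'M[R]_n) : \bar R := usc_env Hdom Hfun (p, X).

(* (p, X, tau) \in J^+ w(z0) *)
Definition superjet (w : V * R -> \bar R) (z0 : V * R)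
    (p : V) (X : 'M[R]_n) (tau : R) : Prop :=
  X^T = X /\
  forall e : R, 0 < e -> \forall z \near z0,
    let h := z.1 - z0.1 in let s := z.2 - z0.2 in
    (w z <= w z0 + (tau * s + dotv p h + 2^-1 * dotv (h *m X) h
                    + e * (`|s| + enorm h ^+ 2))%:E)%E.

(* (p, X, tau) \in J^- w(z0) *)
Definition subjet (w : V * R -> \bar R) (z0 : V * R)
    (p : V) (X : 'M[R]_n) (tau : R) : Prop :=
  superjet (fun z => - w z)%E z0 (- p) (- X) (- tau).

Section Source.
Variables (f : V -> R) (u0 : V -> R).

Definition is_subsolution (u : V * R -> R) : Prop :=
  [/\ locally_bounded spacetime u,
      forall x, (usc_env spacetime u (x, 0%R) <= (u0 x)%:E)%E
    & forall (z : V * R) p X tau, 0 < z.2 ->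
        superjet (usc_env spacetime u) z p X tau ->
        (tau%:E + Hlow p X <= usc_env setT f z.1)%E].

Definition is_supersolution (u : V * R -> R) : Prop :=
  [/\ locally_bounded spacetime u,
      forall x, ((u0 x)%:E <= lsc_env spacetime u (x, 0%R))%E
    & forall (z : V * R) p X tau, 0 < z.2 ->
        subjet (lsc_env spacetime u) z p X tau ->
        (lsc_env setT f z.1 <= tau%:E + Hupp p X)%E].

Definition is_solution (u : V * R -> R) : Prop :=
  is_subsolution u /\ is_supersolution u.

Definition compactly_supported (u : V * R -> R) : Prop :=
  forall T : R, 0 < T -> exists2 r : R, 0 < r &
    forall x t, ~ eball 0 r x -> 0 <= t <= T -> u (x, t) = 0.

Definition is_maximal_solution (u : V * R -> R) : Prop :=
  [/\ is_solution u, compactly_supported u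
    & forall v, is_solution v -> compactly_supported v ->
        forall x t, 0 <= t -> v (x, t) <= u (x, t)].

End Source.

Section Obstacle.
Variable A : set V.

(* The truncation makes the extended real finite. *)
Definition obstacle (x : V) : R :=
  fine (Order.max (-1)%:E
    (Order.min 1%:E (edistance x (~` A) - edistance x A))%E).

(* bounded continuous viscosity solution of the obstacle problem;
   semicontinuous envelopes of v are omitted since v is continuous *)
Definition is_obstacle_solution (v : V * R -> R) : Prop :=
  [/\ [bounded v z | z in spacetime],
      {within spacetime, continuous v},
      forall x, v (x, 0) = obstacle x,
      forall (z : V * R) p X tau, 0 < z.2 ->
        superjet (EFin \o v) z p X tau ->
        (Order.min (tau%:E + Hlow p X) (v z - obstacle z.1)%:E <= 0)%E
    & forall (z : V * R) p X tau, 0 < z.2 ->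
        subjet (EFin \o v) z p X tau ->
        (0 <= Order.min (tau%:E + Hupp p X) (v z - obstacle z.1)%:E)%E].

(* "the" solution of the obstacle problem. The default value 0 is only there
   for totality: with it the front would be empty at all times. *)
Definition obstacle_solution : V * R -> R :=
  xget (fun=> 0) [set v | is_obstacle_solution v].

(* F^+[A](t), for t > 0 *)
Definition front (t : R) : set V := [set x | 0 < obstacle_solution (x, t)].

Definition front_fills_space : Prop :=
  forall K : set V, compact K -> \forall t \near +oo, K `<=` front t.

End Obstacle.

End Equation.

(* Main.v *)
Require Import Defs.
From HB Require Import structures.
From mathcomp Require Import all_boot all_order all_algebra.
From mathcomp Require Import all_classical all_reals all_analysis.
From mathcomp Require Import ring lra.

(** The source is active for all times on [E], so the solution should grow like a
    stack of layers: each layer is born on [E] thanks to the source, then its edge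
    spreads by [V = kappa + 1] as the front started from [E], which by assumption
    reaches any given compact set in a finite time [T]. Since [E] itself is
    reached, a new layer can be born on top of the previous one, and a fixed gain
    per period yields linear growth.

    To make this rigorous, each step builds a subsolution [w] with compact support
    and concludes [w <= u]. The conclusion comes from the maximality of [u]
    (lemma [maximal_solution_ge]): the supremum of all compactly supported
    subsolutions lies below explicit radial barriers (lemmas
    [subsolution_le_linear] and [subsolution_support]) and is a solution by
    Perron's method (lemmas [perron_subsolution] and [perron_supersolution]);
    hence it is a competitor for [u].

    One period of the growth consists of two such steps, starting from [l <= u]
    on [E]. Points of [E] where the obstacle exceeds [d] are centres of balls of
    radius [d] contained in [E], on which a small paraboloid can be glued to [u];
    this gives [l + a <= u] there after a unit of time, for an [a] depending only
    on [c], [d] and the dimension (lemma [birth]). Then a function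
    [moebius a d l] of the obstacle solution [v] is glued to [u]. Being an
    increasing function of [v], it is a subsolution wherever [v] is off the
    obstacle, because the equation is geometric. At contact points it lies below
    [u]: the choice of the function puts it below [0] where [v <= 0], below [l]
    where [v <= d], and everywhere below [l + a]. Where [2 * d <= v] it exceeds
    [l] by a third of [a], whence the gain (lemma [spread]). The margin [d] comes
    from compactness: the region reached at time [T] contains the compact set of
    the statement with [2 * d < v] there (lemma [front_margin]). Iterating gives
    lemma [staircase], and the linear lower bound on the lower semicontinuous
    envelope follows because the region [2 * d < v] is open. *)

Import Order.TTheory GRing.Theory Num.Theory.
Import numFieldNormedType.Exports.

Local Open Scope classical_set_scope.
Local Open Scope ring_scope.

Set Implicit Arguments.
Unset Strict Implicit.
Unset Printing Implicit Defensive.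

(** * Semicontinuous envelopes *)
Section EnvelopeLemmas.
Context {R : realType} {X : topologicalType}.
Implicit Types (D : set X) (f g : X -> R) (z : X) (a b : \bar R).
Local Open Scope ereal_scope.

Lemma usc_env_lt_near {D f z a} : usc_env D f z < a ->
  exists2 b, b < a & \forall z' \near z, D z' -> (f z')%:E <= b.
Proof.
move=> /ereal_inf_lt[_ [A /= wA <-] sA]; exists (ereal_sup ((EFin \o f) @` A)) => //.
move: wA; rewrite /within /=; apply: filterS => z' AD Dz'.
by apply: ereal_sup_ubound; exists z' => //; exact: AD.
Qed.

Lemma usc_env_le {D f z a} :
  (\forall z' \near z, D z' -> (f z')%:E <= a) -> usc_env D f z <= a.
Proof.
move=> H; apply: (@le_trans _ _ (ereal_sup ((EFin \o f) @` [set z' | (f z')%:E <= a]))).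
  by apply: ereal_inf_lbound; exists [set z' | (f z')%:E <= a].
by apply: ge_ereal_sup => _ [z' /= ? <-].
Qed.

Lemma usc_env_near_lt {D f z a} : usc_env D f z < a ->
  \forall z' \near z, usc_env D f z' < a.
Proof.
move=> /usc_env_lt_near[b ba /nbhs_interior]; apply: filterS => z' Hz'.
exact: le_lt_trans (usc_env_le Hz') ba.
Qed.

Lemma usc_env_ge {D} f {z} : D z -> (f z)%:E <= usc_env D f z.
Proof.
move=> Dz; apply: le_ereal_inf_tmp => _ [A /nbhs_singleton Az <-].
by apply: ereal_sup_ubound; exists z => //; exact: Az.
Qed.

Lemma usc_env_gt_near {D f z a} {U : set X} : a < usc_env D f z -> nbhs z U ->
  exists z', [/\ U z', D z' & a < (f z')%:E].
Proof.
move=> af Uz; apply: contrapT => H; move: af; rewrite ltNge => /negP; apply.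
apply: usc_env_le; apply: filterS Uz => z' Uz' Dz'; rewrite leNgt.
by apply/negP => ?; apply: H; exists z'.
Qed.

Lemma usc_env_le_env {D f g z} :
  (\forall z' \near z, D z' -> (f z' <= g z')%R) ->
  usc_env D f z <= usc_env D g z.
Proof.
move=> fg; rewrite leNgt; apply/negP => /usc_env_lt_near[b bf H].
move: bf; rewrite ltNge => /negP; apply; apply: usc_env_le.
by apply: filterS2 fg H => z' fg H Dz'; apply: le_trans (H Dz'); rewrite lee_fin fg.
Qed.

Lemma lsc_envE D f z : lsc_env D f z = - usc_env D (fun z => - f z)%R z.
Proof. by []. Qed.

Lemma lsc_env_ge {D f z a} :
  (\forall z' \near z, D z' -> a <= (f z')%:E) -> a <= lsc_env D f z.
Proof.
move=> H; rewrite lsc_envE leeNr; apply: usc_env_le; apply: filterS H => z' H /H.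
by rewrite EFinN leeN2.
Qed.

Lemma lsc_env_le {D} f {z} : D z -> lsc_env D f z <= (f z)%:E.
Proof. by move=> Dz; rewrite lsc_envE leeNl -EFinN; exact: (usc_env_ge (fun z => - f z)%R). Qed.

Lemma lsc_env_gt_near {D f z a} : a < lsc_env D f z ->
  exists2 b, a < b & \forall z' \near z, D z' -> b <= (f z')%:E.
Proof.
rewrite lsc_envE lteNr => /usc_env_lt_near[b ba H]; exists (- b); first by rewrite lteNr.
by apply: filterS H => z' H /H; rewrite EFinN leeNl.
Qed.

Lemma lsc_env_near_gt {D f z a} : a < lsc_env D f z ->
  \forall z' \near z, a < lsc_env D f z'.
Proof.
move=> /lsc_env_gt_near[b ba /nbhs_interior]; apply: filterS => z' Hz'.
exact: lt_le_trans ba (lsc_env_ge Hz').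
Qed.

Lemma lsc_env_lt_near {D f z a} {U : set X} : lsc_env D f z < a -> nbhs z U ->
  exists z', [/\ U z', D z' & (f z')%:E < a].
Proof.
rewrite lsc_envE lteNl => H /(usc_env_gt_near H)[z' [? ?]]; rewrite EFinN lteN2 => ?.
by exists z'.
Qed.

Lemma env_continuous {D f z} : D z -> {for z, continuous f} ->
  usc_env D f z = (f z)%:E.
Proof.
move=> Dz cf; apply/eqP; rewrite eq_le usc_env_ge// andbT.
apply/lee_addgt0Pr => e e0; apply: usc_env_le.
have := cf (ball (f z) e) (nbhsx_ballx _ _ e0).
rewrite nbhs_simpl /=; apply: filterS => z' /=.
rewrite /ball/= ltr_distlC => /andP[_ /ltW]; by rewrite -EFinD lee_fin.
Qed.

Lemma usc_env_fin {D f z} : D z -> locally_bounded D f ->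
  exists a : R, usc_env D f z = a%:E.
Proof.
move=> Dz /(_ _ Dz) [M [_ /(_ (M + 1)%R)]]; rewrite ltrDl ltr01 => /(_ isT).
rewrite /prop_near1/within/= => H.
have : usc_env D f z <= (M + 1)%:E.
  by apply: usc_env_le; apply: filterS H => z' H /H; rewrite lee_fin ler_norml => /andP[].
have := usc_env_ge f Dz.
by case: (usc_env D f z) => // r; exists r.
Qed.

Lemma lsc_env_fin {D f z} : D z -> locally_bounded D f ->
  exists a : R, lsc_env D f z = a%:E.
Proof.
move=> Dz lf; have [|a aE] := @usc_env_fin D (fun z => - f z)%R z Dz; last first.
  by exists (- a)%R; rewrite lsc_envE aE.
move=> y Dy; have [M [? H]] := lf y Dy; exists M; split=> // r Mr.
by have := H _ Mr; rewrite /prop_near1/within/=; apply: filterS => w; rewrite normrN.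
Qed.

End EnvelopeLemmas.

(** * Euclidean geometry *)
Section EuclideanLemmas.
Context {R : realType} {n : nat}.
Implicit Types (x y h p : 'rV[R]_n) (k e : R) (X : 'M[R]_n).

Lemma dotvE x y : dotv x y = \sum_i x 0 i * y 0 i.
Proof. by rewrite /dotv mxE; apply: eq_bigr => i _; rewrite mxE. Qed.

Lemma dotvC x y : dotv x y = dotv y x.
Proof. by rewrite !dotvE; apply: eq_bigr => i _; rewrite mulrC. Qed.

Lemma dotvDl x y h : dotv (x + y) h = dotv x h + dotv y h.
Proof. by rewrite /dotv mulmxDl mxE. Qed.

Lemma dotvZl k x y : dotv (k *: x) y = k * dotv x y.
Proof. by rewrite /dotv -scalemxAl mxE. Qed.

Lemma dotvNl x y : dotv (- x) y = - dotv x y.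
Proof. by rewrite -scaleN1r dotvZl mulN1r. Qed.

Lemma dotvBl x y h : dotv (x - y) h = dotv x h - dotv y h.
Proof. by rewrite dotvDl dotvNl. Qed.

Lemma dotvDr x y h : dotv h (x + y) = dotv h x + dotv h y.
Proof. by rewrite !(dotvC h) dotvDl. Qed.

Lemma dotvZr k x y : dotv y (k *: x) = k * dotv y x.
Proof. by rewrite !(dotvC y) dotvZl. Qed.

Lemma dotvNr x y : dotv y (- x) = - dotv y x.
Proof. by rewrite !(dotvC y) dotvNl. Qed.

Lemma dotvBr x y h : dotv h (x - y) = dotv h x - dotv h y.
Proof. by rewrite dotvDr dotvNr. Qed.

Lemma dot0v x : dotv 0 x = 0.
Proof. by rewrite -(scale0r 0) dotvZl mul0r. Qed.

Lemma dotv0 x : dotv x 0 = 0.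
Proof. by rewrite dotvC dot0v. Qed.

Lemma dotv_mulmx X x y : dotv (x *m X) y = dotv x (y *m X^T).
Proof. by rewrite /dotv trmx_mul trmxK mulmxA. Qed.

Lemma dotv_ge0 x : 0 <= dotv x x.
Proof. by rewrite dotvE; apply: sumr_ge0 => i _; rewrite -expr2 sqr_ge0. Qed.

Lemma dotv_eq0 x : (dotv x x == 0) = (x == 0).
Proof.
apply/eqP/eqP => [|->]; last exact: dot0v.
rewrite dotvE => /eqP; rewrite psumr_eq0 => [/allP H|i _]; last by rewrite -expr2 sqr_ge0.
apply/rowP => i; rewrite mxE; apply/eqP.
by have := H i; rewrite mem_index_enum mulf_eq0 orbb => /(_ isT).
Qed.

Lemma dotvv x : dotv x x = enorm x ^+ 2.
Proof. by rewrite sqr_sqrtr// dotv_ge0. Qed.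

Lemma enorm_ge0 x : 0 <= enorm x. Proof. exact: sqrtr_ge0. Qed.

Lemma enorm_eq0 x : (enorm x == 0) = (x == 0).
Proof. by rewrite -dotv_eq0 dotvv sqrf_eq0. Qed.

Lemma enorm0 : enorm (0 : 'rV[R]_n) = 0.
Proof. by apply/eqP; rewrite enorm_eq0. Qed.

Lemma enormZ k x : enorm (k *: x) = `|k| * enorm x.
Proof. by rewrite /enorm dotvZl dotvZr mulrA -expr2 sqrtrM ?sqr_ge0// sqrtr_sqr. Qed.

Lemma enormN x : enorm (- x) = enorm x.
Proof. by rewrite -scaleN1r enormZ normrN1 mul1r. Qed.

Lemma enormBC x y : enorm (x - y) = enorm (y - x).
Proof. by rewrite -enormN opprB. Qed.

Lemma ler_dotv x y : `|dotv x y| <= enorm x * enorm y.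
Proof.
have [->|y0] := eqVneq y 0; first by rewrite dotv0 normr0 mulr_ge0// enorm_ge0.
rewrite -(@ler_pXn2r _ 2)// ?nnegrE ?mulr_ge0 ?enorm_ge0//.
rewrite real_normK ?num_real// exprMn -!dotvv.
have yy0 : 0 < dotv y y by rewrite lt_neqAle dotv_ge0 eq_sym dotv_eq0 y0.
have := dotv_ge0 (dotv y y *: x - dotv x y *: y).
rewrite dotvBl !dotvBr !dotvZl !dotvZr (dotvC y x).
set a := dotv x x; set b := dotv y y; set c := dotv x y.
rewrite (_ : _ - _ = b * (a * b - c ^+ 2)); last by ring.
by rewrite pmulr_rge0// subr_ge0.
Qed.

Lemma ler_enormD x y : enorm (x + y) <= enorm x + enorm y.
Proof.
rewrite -(@ler_pXn2r _ 2)// ?nnegrE ?addr_ge0 ?enorm_ge0//.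
rewrite sqrrD -!dotvv dotvDl !dotvDr (dotvC y x).
have := ler_dotv x y; rewrite ler_norml => /andP[_]; lra.
Qed.

Lemma enorm_coord x i : `|x 0 i| <= enorm x.
Proof.
rewrite -(@ler_pXn2r _ 2)// ?nnegrE ?enorm_ge0// -dotvv real_normK ?num_real//.
rewrite dotvE (bigD1 i)//= -expr2 lerDl.
by apply: sumr_ge0 => j _; rewrite -expr2 sqr_ge0.
Qed.

Lemma mx_norm_le_enorm x : `|x| <= enorm x.
Proof.
rewrite [leLHS]/Num.norm/= mx_normrE; apply/bigmax_leP; split=> [|[i j] _].
  exact: enorm_ge0.
by rewrite ord1 enorm_coord.
Qed.

Lemma mx_norm_coord X i j : `|X i j| <= `|X|.
Proof.
rewrite [leRHS]/Num.norm/= mx_normrE; apply: (@le_bigmax _ _ _ _ (fun i => `|X i.1 i.2|) (i, j)).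
Qed.

Lemma row_norm_coord x i : `|x 0 i| <= `|x|.
Proof.
rewrite [leRHS]/Num.norm/= mx_normrE; apply: (@le_bigmax _ _ _ _ (fun i => `|x i.1 i.2|) (0, i)).
Qed.

Lemma enorm_le_mx_norm x : enorm x <= n.+1%:R * `|x|.
Proof.
rewrite -(@ler_pXn2r _ 2)// ?nnegrE ?mulr_ge0 ?enorm_ge0// -dotvv dotvE.
apply: (@le_trans _ _ (\sum_(i < n) `|x| ^+ 2)).
  apply: ler_sum => i _; rewrite -expr2 -real_normK ?num_real//.
  by rewrite ler_pXn2r ?nnegrE// row_norm_coord.
rewrite sumr_const card_ord exprMn -[leLHS]mulr_natl ler_wpM2r ?exprn_ge0// -natrX ler_nat.
by rewrite expnS expn1 (leq_trans (leqnSn n))// leq_pmulr.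
Qed.

Lemma ler_quad X h : exists2 K : R, 0 <= K &
  forall h, `|dotv (h *m X) h| <= K * enorm h ^+ 2.
Proof.
exists (\sum_i \sum_j `|X i j|).
  by apply: sumr_ge0 => i _; apply: sumr_ge0.
move=> {}h; rewrite dotvE.
have -> : \sum_i (h *m X) 0 i * h 0 i = \sum_i \sum_j h 0 j * X j i * h 0 i.
  by apply: eq_bigr => i _; rewrite mxE mulr_suml.
rewrite exchange_big/= mulr_suml; apply: le_trans (ler_norm_sum _ _ _) _.
apply: ler_sum => i _; rewrite mulr_suml; apply: le_trans (ler_norm_sum _ _ _) _.
apply: ler_sum => j _; rewrite !normrM mulrAC mulrC ler_wpM2l// expr2.
by rewrite ler_pM// enorm_coord.
Qed.

(** ** Euclidean neighbourhoods *)

Lemma nbhs_eballP {x} {P : set 'rV[R]_n} :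
  nbhs x P <-> exists2 e, 0 < e & forall y, enorm (y - x) < e -> P y.
Proof.
split=> [/nbhs_ballP[e /= e0 H]|[e e0 H]].
  exists e => // y yx; apply: H; rewrite mx_norm_ball /ball_/= distrC.
  exact: le_lt_trans (mx_norm_le_enorm _) yx.
apply/nbhs_ballP; exists (e / n.+1%:R) => /=; first by rewrite divr_gt0.
move=> y; rewrite mx_norm_ball /ball_/= distrC => yx; apply: H.
by apply: le_lt_trans (enorm_le_mx_norm _) _; rewrite mulrC -ltr_pdivlMr.
Qed.

(** Turns neighbourhoods in the product of a sup norm with the line into the
    quantities measured by semijets. *)
Lemma nbhs_boxP {z : 'rV[R]_n * R} {P : set ('rV[R]_n * R)} :
  nbhs z P <-> exists2 e, 0 < e &
    forall w, enorm (w.1 - z.1) < e -> `|w.2 - z.2| < e -> P w.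
Proof.
split=> [[[A B] /= [/nbhs_eballP[e e0 HA] /nbhs_ballP[d /= d0 HB]] H]|[e e0 H]].
  exists (Num.min e d); first by rewrite lt_min e0 d0.
  move=> w; rewrite !lt_min => /andP[we _] /andP[_ wd]; apply: H; split; first exact: HA.
  by apply: HB; rewrite /ball/= distrC.
exists ([set y | enorm (y - z.1) < e], ball z.2 e) => /=.
  by split; [apply/nbhs_eballP; exists e|exact: nbhsx_ballx].
by move=> w [/= ? ?]; apply: H => //; rewrite distrC.
Qed.

Lemma ler_enormB x y : `|enorm x - enorm y| <= enorm (x - y).
Proof.
rewrite ler_norml !lerBlDr; apply/andP; split.
  rewrite lerNl opprB lerBlDl enormBC; apply: le_trans (ler_enormD _ _).
  by rewrite subrKC.
by apply: le_trans (ler_enormD _ _); rewrite subrK.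
Qed.

Lemma enormB_continuous x : continuous (fun y : 'rV[R]_n => enorm (y - x) : R).
Proof.
move=> y; apply/(@cvgrPdist_lt R R^o _ (nbhs y)) => e e0; apply/nbhs_eballP; exists e => // y'.
rewrite enormBC; apply: le_lt_trans.
by apply: le_trans (ler_enormB _ _) _; rewrite opprB addrA subrK.
Qed.

Lemma compact_box x k (a b : R) :
  compact ([set y | enorm (y - x) <= k] `*` `[a, b]%classic).
Proof.
apply: compact_setX; last exact: segment_compact.
apply: bounded_closed_compact.
  exists (`|x| + k); split; first exact: num_real.
  move=> M xM y /= yx; apply: ltW; apply: le_lt_trans xM.
  rewrite -[y](subrK x) addrC; apply: le_trans (ler_normD _ _) _.
  by rewrite lerD2l; apply: le_trans yx; exact: mx_norm_le_enorm.
have -> : [set y | enorm (y - x) <= k] = (fun y => enorm (y - x)) @^-1` [set t | t <= k] by [].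
apply: preimage_closed; last exact: closed_le.
by move=> y _; exact: enormB_continuous.
Qed.

End EuclideanLemmas.

(** * Extended reals *)
Section ErealLemmas.
Context {R : realType}.
Implicit Types (a e : R) (y : \bar R).

Lemma lee_fin_subP a y : (forall e, 0 < e -> ((a - e)%:E <= y)%E) -> (a%:E <= y)%E.
Proof.
case: y => [y H| |H].
- by rewrite lee_fin; apply/ler_addgt0Pr => e e0; have := H e e0; rewrite lee_fin lerBlDr.
- by rewrite leey.
- by have := H 1 ltr01; rewrite leeNy_eq.
Qed.

End ErealLemmas.

Lemma near_all {T : topologicalType} (z : T) (P : T -> Prop) :
  (forall y, P y) -> \forall y \near z, P y.
Proof. by move=> H; apply: nearW. Qed.

(** * The curvature operator *)
Section Operator.
Context {R : realType} {n : nat}.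
Implicit Types (p q h : 'rV[R]_n) (k e a b : R) (X Y Z : 'M[R]_n).

Definition qform X h : R := dotv (h *m X) h.

Lemma qformDl X Y h : qform (X + Y) h = qform X h + qform Y h.
Proof. by rewrite /qform mulmxDr dotvDl. Qed.

Lemma qformZl k X h : qform (k *: X) h = k * qform X h.
Proof. by rewrite /qform -scalemxAr dotvZl. Qed.

Lemma qformNl X h : qform (- X) h = - qform X h.
Proof. by rewrite -scaleN1r qformZl mulN1r. Qed.

Lemma qform_scalar k h : qform k%:M h = k * enorm h ^+ 2.
Proof. by rewrite /qform mul_mx_scalar dotvZl dotvv. Qed.

Lemma qform_outer p h : qform (p^T *m p) h = dotv p h ^+ 2.
Proof.
rewrite /qform mulmxA {1}/dotv -mulmxA mxE big_ord1 expr2; congr (_ * _).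
by rewrite dotvC.
Qed.

Lemma qformZr X k h : qform X (k *: h) = k ^+ 2 * qform X h.
Proof. by rewrite /qform -scalemxAl dotvZl dotvZr mulrA. Qed.

Lemma qformD X h h' : X^T = X ->
  qform X (h + h') = qform X h + 2 * dotv (h *m X) h' + qform X h'.
Proof.
move=> sX; rewrite /qform mulmxDl dotvDl !dotvDr.
rewrite (dotv_mulmx X h' h) sX (dotvC h'); ring.
Qed.

Lemma mxnorm_outer p q : `|p^T *m q| <= enorm p * enorm q.
Proof.
rewrite [leLHS]/Num.norm/= mx_normrE; apply/bigmax_leP; split=> [|[i j] _].
  by rewrite mulr_ge0// enorm_ge0.
by rewrite mxE big_ord1 mxE normrM ler_pM// enorm_coord.
Qed.

Lemma sigma_sym p : (sigma p)^T = sigma p.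
Proof.
by rewrite /sigma linearB/= linearZ/= trmx1 trmx_mul trmxK.
Qed.

Lemma mul_outer p : p^T *m p *m (p^T *m p) = enorm p ^+ 2 *: (p^T *m p).
Proof.
rewrite -dotvv mulmxA -[p^T *m p *m p^T]mulmxA.
have -> : p *m p^T = (dotv p p)%:M by rewrite /dotv -mx11_scalar.
by rewrite mul_mx_scalar scalemxAl.
Qed.

Lemma sigma_idem p : p != 0 -> sigma p *m sigma p = sigma p.
Proof.
move=> p0; have e0 : enorm p ^+ 2 != 0 by rewrite sqrf_eq0 enorm_eq0.
rewrite /sigma mulmxBr mulmx1 mulmxBl mul1mx -scalemxAr -scalemxAl mul_outer.
by rewrite (scalerA _ (enorm p ^+ 2)) mulVf// scale1r subrr subr0.
Qed.

Lemma sigma_outer p : p != 0 -> sigma p *m (p^T *m p) = 0.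
Proof.
move=> p0; have e0 : enorm p ^+ 2 != 0 by rewrite sqrf_eq0 enorm_eq0.
by rewrite /sigma mulmxBl mul1mx -scalemxAl mul_outer scalerA mulVf// scale1r subrr.
Qed.

Lemma sigmaZ k p : k != 0 -> sigma (k *: p) = sigma p.
Proof.
move=> k0; rewrite /sigma enormZ.
have -> : (k *: p)^T *m (k *: p) = k ^+ 2 *: (p^T *m p).
  by apply/matrixP => i j; rewrite !mxE !big_ord1 !mxE; ring.
rewrite scalerA; congr (_ - _ *: _); rewrite exprMn invfM real_normK ?num_real//.
by rewrite mulrAC mulVf ?mul1r// expf_neq0.
Qed.

Lemma mxtrace_outer p : \tr (p^T *m p) = enorm p ^+ 2.
Proof. by rewrite mxtrace_mulC trace_mx11 -dotvv. Qed.

Lemma mxtrace_sigma p : p != 0 -> \tr (sigma p) = n%:R - 1.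
Proof.
move=> p0; have e0 : enorm p ^+ 2 != 0 by rewrite sqrf_eq0 enorm_eq0.
by rewrite /sigma linearB/= linearZ/= mxtrace1 mxtrace_outer mulVf.
Qed.

(** Since [sigma p] is an orthogonal projection, this is the trace of the
    compression of [Y] to the hyperplane orthogonal to [p]. *)
Lemma mxtrace_sigma_ge0 p Y : p != 0 -> (forall h, 0 <= qform Y h) ->
  0 <= \tr (sigma p *m Y).
Proof.
move=> p0 Y0; rewrite -{1}(sigma_idem p0) -mulmxA mxtrace_mulC.
apply: sumr_ge0 => i _; have := Y0 (row i (sigma p)).
rewrite /qform /dotv -row_mul tr_row -{2}(sigma_sym p) trmxK.
suff -> : (row i (sigma p *m Y) *m col i (sigma p)) 0 0 = (sigma p *m Y *m sigma p) i i.
  by [].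
rewrite [LHS]mxE [RHS]mxE; apply: eq_bigr => k _.
by congr (_ * _); rewrite [LHS]mxE.
Qed.

Lemma sigma_coord p i j : p != 0 -> `|sigma p i j| <= 2.
Proof.
move=> p0; have e0 : 0 < enorm p ^+ 2 by rewrite exprn_gt0// lt_neqAle enorm_ge0 eq_sym enorm_eq0 p0.
rewrite /sigma !mxE big_ord1 mxE; apply: le_trans (ler_normB _ _) _.
rewrite -[2]/(1 + 1) lerD//; first by case: eqP => _; rewrite ?normr1 ?normr0.
rewrite normrM normfV (ger0_norm (ltW e0)) mulrC ler_pdivrMr// mul1r normrM expr2.
by rewrite ler_pM// enorm_coord.
Qed.

Lemma mxtrace_sigma_le p Y : p != 0 ->
  `|\tr (sigma p *m Y)| <= n%:R ^+ 2 * 2 * `|Y|.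
Proof.
move=> p0; apply: le_trans (ler_norm_sum _ _ _) _.
apply: (@le_trans _ _ (\sum_(i < n) n%:R * 2 * `|Y|)); last first.
  by rewrite sumr_const card_ord -[leLHS]mulr_natl !mulrA -expr2.
apply: ler_sum => i _; rewrite mxE; apply: le_trans (ler_norm_sum _ _ _) _.
apply: (@le_trans _ _ (\sum_(i < n) 2 * `|Y|)); last first.
  by rewrite sumr_const card_ord -[leLHS]mulr_natl !mulrA.
by apply: ler_sum => j _; rewrite normrM ler_pM ?sigma_coord ?mx_norm_coord.
Qed.

Lemma nbhs_mxP {p X} {P : set ('rV[R]_n * 'M[R]_n)} :
  nbhs (p, X) P <-> exists2 e, 0 < e &
    forall q Z, enorm (q - p) < e -> `|Z - X| < e -> P (q, Z).
Proof.
split=> [[[A B] /= [/nbhs_eballP[e e0 HA] /nbhs_ballP[d /= d0 HB]] H]|[e e0 H]].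
  exists (Num.min e d); first by rewrite lt_min e0 d0.
  move=> q Z; rewrite !lt_min => /andP[we _] /andP[_ wd]; apply: H; split; first exact: HA.
  by apply: HB; rewrite mx_norm_ball /ball_/= distrC.
exists ([set y | enorm (y - p) < e], ball X e) => /=.
  by split; [apply/nbhs_eballP; exists e|exact: nbhsx_ballx].
by move=> [q Z] [/= ?]; rewrite mx_norm_ball /ball_/= => ?; apply: H => //; rewrite distrC.
Qed.

(** Keeps the envelopes of [Hfun] from degenerating at [p = 0]; in dimension 0
    the domain is empty. *)
Lemma Hdom_near (n_gt0 : (0 < n)%N) p X e : X^T = X -> 0 < e ->
  exists2 q, enorm (q - p) < e & Hdom (q, X).
Proof.
move=> sX e0; have [p0|p0] := eqVneq p 0; last first.
  by exists p; [rewrite subrr enorm0|split].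
pose v : 'rV[R]_n := const_mx 1.
have v0 : v != 0.
  apply/eqP => /rowP /(_ (Ordinal n_gt0)); rewrite !mxE => /eqP; by rewrite oner_eq0.
have ev0 : 0 < enorm v by rewrite lt_neqAle enorm_ge0 eq_sym enorm_eq0 v0.
exists ((e / 2 / enorm v) *: v).
  rewrite p0 subr0 enormZ gtr0_norm ?divr_gt0// divfK ?gt_eqF//; lra.
by split => //=; rewrite scaler_eq0 negb_or v0 andbT gt_eqF// !divr_gt0.
Qed.

(** Degenerate ellipticity: translating the matrix variable by [Y - X] maps
    neighbourhoods of (p, X) to those of (p, Y) and decreases [Hfun]. *)
Lemma Hlow_mono p X Y : X^T = X -> Y^T = Y -> (forall h, qform X h <= qform Y h) ->
  (Hlow p Y <= Hlow p X)%E.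
Proof.
move=> sX sY XY; rewrite leNgt; apply/negP => H.
have [b Xb /nbhs_mxP[e e0 He]] := lsc_env_gt_near H.
have /(lsc_env_lt_near Xb) : nbhs (p, X) [set w | enorm (w.1 - p) < e /\ `|w.2 - X| < e].
  by apply/nbhs_mxP; exists e.
move=> [[q Z] [/= [qp ZX] [/= q0 sZ] Hb]].
have ZY : `|Z + (Y - X) - Y| < e by rewrite addrCA addrAC subrr add0r addrC in ZX *.
have hd : Hdom (q, Z + (Y - X)) by split=> //=; rewrite !linearD/= linearN/= sX sY sZ.
have := lt_le_trans Hb (He q (Z + (Y - X)) qp ZY hd).
rewrite lte_fin /Hfun/= ltNge => /negP; apply.
rewrite lerD2r lerN2 mulmxDr linearD/= lerDl; apply: mxtrace_sigma_ge0 => // h.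
by rewrite qformDl qformNl subr_ge0.
Qed.

Lemma Hfun_geometric q Z k m : q != 0 -> 0 < k ->
  Hfun (k *: q, k *: Z + m *: (q^T *m q)) = k * Hfun (q, Z).
Proof.
move=> q0 k0; rewrite /Hfun/= sigmaZ ?gt_eqF// enormZ gtr0_norm// mulmxDr mxtraceD.
rewrite -!scalemxAr sigma_outer// scaler0 mxtrace0 addr0 mxtraceZ; ring.
Qed.

(** Geometric invariance passes to the envelope because the map sending (q, Z)
    to (k q, k Z + m q^T q) is a homeomorphism which multiplies [Hfun] by [k].
    It is what allows the level sets of a subsolution to be relabelled. *)
Lemma Hlow_geometric p X k m a : 0 < k ->
  (a%:E <= Hlow p X -> (k * a)%:E <= Hlow (k *: p) (k *: X + m *: (p^T *m p)))%E.
Proof.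
move=> k0 aH; apply: lee_fin_subP => e e0.
have : ((a - e / k)%:E < Hlow p X)%E.
  by apply: lt_le_trans aH; rewrite lte_fin ltrBlDr ltrDl divr_gt0.
move=> /lsc_env_gt_near[b ab /nbhs_mxP[d d0 Hd]]; apply: lsc_env_ge.
apply/nbhs_mxP; pose s := k^-1.
have s0 : 0 < s by rewrite invr_gt0.
have sk : s * k = 1 by rewrite mulVf// gt_eqF.
pose N := s * `|m| * (2 * enorm p + 1).
have N0 : 0 <= N by rewrite mulr_ge0 ?addr_ge0 ?mulr_ge0 ?enorm_ge0// ltW.
pose r := Num.min 1 (d / 2 / (N + 1)).
have N1 : 0 < N + 1 by rewrite ltr_wpDl.
have r0 : 0 < r by rewrite lt_min ltr01 !divr_gt0.
have r1 : r <= 1 by rewrite ge_min lexx.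
have rN : r * (N + 1) <= d / 2 by rewrite -ler_pdivlMr// ge_min lexx orbT.
(* [N] bounds the variation of [s * m *: (q^T *m q)] per unit of distance to [p] *)
exists (k * r) => [|q Z qp ZX [/= q0 sZ]]; first by rewrite mulr_gt0.
pose q' := s *: q.
have qE : q = k *: q' by rewrite scalerA mulrC sk scale1r.
have q'p : enorm (q' - p) < r.
  move: qp; rewrite qE -scalerBr enormZ gtr0_norm// ltr_pM2l//.
pose Z' := s *: (Z - m *: (q'^T *m q')).
have ZE : Z = k *: Z' + m *: (q'^T *m q') by rewrite scalerA mulrC sk scale1r subrK.
have q'0 : q' != 0 by rewrite scaler_eq0 negb_or q0 andbT gt_eqF.
have Z'X : `|Z' - X| < d.
  have -> : Z' - X = s *: (Z - (k *: X + m *: (p^T *m p)))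
      - (s * m) *: ((q' - p)^T *m q' + p^T *m (q' - p)).
    rewrite {1}ZE; clearbody Z'; apply/matrixP => i j; rewrite !mxE !big_ord1 !mxE.
    have Z1 : s * k * Z' i j = Z' i j by rewrite sk mul1r.
    have X1 : s * k * X i j = X i j by rewrite sk mul1r.
    by rewrite -{1}Z1 -{1}X1; ring.
  apply: le_lt_trans (ler_normB _ _) _; rewrite normrZ [X in _ + X]normrZ.
  have : `|s| * `|Z - (k *: X + m *: (p^T *m p))| < r.
    by rewrite gtr0_norm// -[ltRHS]mul1r -sk -mulrA ltr_pM2l.
  have : `|s * m| * `|(q' - p)^T *m q' + p^T *m (q' - p)| <= N * r.
    rewrite normrM (gtr0_norm s0) /N -!mulrA ler_wpM2l ?(ltW s0)// ler_wpM2l//.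
    apply: le_trans (ler_normD _ _) _.
    apply: le_trans (lerD (mxnorm_outer _ _) (mxnorm_outer _ _)) _.
    have : enorm q' <= enorm p + 1.
      rewrite -[q'](subrK p) addrC; apply: le_trans (ler_enormD _ _) _.
      by rewrite lerD2l (le_trans (ltW q'p)).
    have := enorm_ge0 p; have := enorm_ge0 (q' - p); move: q'p; nra.
  move=> h1 h2; apply: lt_le_trans (ltr_leD h2 h1) _; move: rN d0; lra.
have := Hd q' Z' _ Z'X => /(_ _)/(_ _)/(le_trans (ltW ab)).
have rd : r <= d by move: rN N0 r0; nra.
have hd : Hdom (q', Z').
  by split=> //=; rewrite /Z' linearZ/= linearB/= linearZ/= trmx_mul trmxK sZ.
move=> /(_ (lt_le_trans q'p rd) hd); rewrite !lee_fin => H.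
rewrite ZE qE Hfun_geometric//; apply: le_trans (_ : k * (a - e / k) <= _).
  by rewrite mulrBr mulrCA divff ?gt_eqF// mulr1.
by rewrite ler_pM2l.
Qed.

Lemma Hlow_scalar_ge p k :
  ((- (k * (n%:R - 1)) - enorm p)%:E <= Hlow p k%:M)%E.
Proof.
apply: lee_fin_subP => e e0; apply: lsc_env_ge.
pose N : R := n%:R ^+ 2 * 2 + 1.
have N1 : 1 <= N by rewrite lerDr mulr_ge0// exprn_ge0.
have N0 : 0 < N by exact: lt_le_trans N1.
apply/nbhs_mxP; exists (e / 2 / N) => [|q Z qp ZX [/= q0 sZ]]; first by rewrite !divr_gt0.
rewrite lee_fin /Hfun/=.
have -> : Z = k%:M + (Z - k%:M) by rewrite addrC subrK.
rewrite mulmxDr mxtraceD mul_mx_scalar mxtraceZ mxtrace_sigma//.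
have := mxtrace_sigma_le (Z - k%:M) q0; rewrite ler_norml => /andP[_].
have : enorm q <= enorm p + enorm (q - p).
  by rewrite -{1}[q](subrK p) addrC; exact: ler_enormD.
have : N * `|Z - k%:M| <= e / 2 by rewrite mulrC -ler_pdivlMr// ltW.
have : enorm (q - p) <= e / 2.
  by apply: le_trans (ltW qp) _; rewrite ler_pdivrMr// ler_peMr// ltW// divr_gt0.
have := normr_ge0 (Z - k%:M); rewrite /N; lra.
Qed.

Lemma Hlow_scalar_le (n_gt0 : (0 < n)%N) p k :
  (Hlow p k%:M <= (- (k * (n%:R - 1)))%:E)%E.
Proof.
rewrite leNgt; apply/negP => /lsc_env_gt_near[b ab /nbhs_mxP[e e0 He]].
have [q qp hd] := Hdom_near n_gt0 p (tr_scalar_mx _ k) e0.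
have := He q k%:M qp; rewrite subrr normr0 => /(_ e0 hd).
apply/negP; rewrite -ltNge; apply: le_lt_trans ab; rewrite lee_fin /Hfun/=.
rewrite mul_mx_scalar mxtraceZ mxtrace_sigma; last by case: hd.
by rewrite gerBl enorm_ge0.
Qed.

Lemma Hlow_le_Hupp (n_gt0 : (0 < n)%N) p X : X^T = X -> (Hlow p X <= Hupp p X)%E.
Proof.
move=> sX; rewrite leNgt; apply/negP => /lsc_env_gt_near[b ab /nbhs_mxP[e e0 He]].
have [b' b'b /nbhs_mxP[e' e'0 He']] := usc_env_lt_near ab.
have ee0 : 0 < Num.min e e' by rewrite lt_min e0.
have [q] := Hdom_near n_gt0 p sX ee0; rewrite lt_min => /andP[qe qe'] hd.
have := He q X qe; rewrite subrr normr0 => /(_ e0 hd) bH.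
have := He' q X qe'; rewrite subrr normr0 => /(_ e'0 hd) /(le_trans bH).
by rewrite leNgt b'b.
Qed.

End Operator.

(** * Calculus of semijets *)
Section Jets.
Context {R : realType} {n : nat}.
Local Notation V := 'rV[R]_n.
Implicit Types (p h : V) (X Y : 'M[R]_n) (z : V * R) (w : V * R -> \bar R)
  (b g : V * R -> R) (t k e : R).

(** The polynomial of a semijet at [z0]. The crease [e * |s|] in time makes the
    same formula serve as a bump whose time profile is a tent, and as the lower
    bound which a subjet provides. *)
Definition quad z0 k p X t e z : R :=
  k + t * (z.2 - z0.2) + dotv p (z.1 - z0.1) + 2^-1 * qform X (z.1 - z0.1)
    - e * `|z.2 - z0.2|.

Lemma qform0 X : qform X 0 = 0.
Proof. by rewrite /qform mul0mx dot0v. Qed.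

Lemma quad0E z0 p X t z :
  quad z0 0 p X t 0 z =
  t * (z.2 - z0.2) + dotv p (z.1 - z0.1) + 2^-1 * qform X (z.1 - z0.1).
Proof. by rewrite /quad mul0r subr0 add0r. Qed.

Lemma superjetP w z0 p X t : superjet w z0 p X t <-> X^T = X /\
  forall e, 0 < e -> exists2 d, 0 < d & forall z,
    enorm (z.1 - z0.1) < d -> `|z.2 - z0.2| < d ->
    (w z <= w z0 + (quad z0 0 p X t 0 z
      + e * (`|z.2 - z0.2| + enorm (z.1 - z0.1) ^+ 2))%:E)%E.
Proof.
split=> -[sX H]; split=> // e e0; have := H e e0.
  move=> /nbhs_boxP[d d0 Hd]; exists d => // z zh zs.
  by rewrite /quad mul0r subr0 add0r; exact: Hd.
move=> [d d0 Hd]; apply/nbhs_boxP; exists d => // z zh zs.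
by have := Hd z zh zs; rewrite /quad mul0r subr0 add0r.
Qed.

Lemma superjet_sym w z0 p X t : superjet w z0 p X t -> X^T = X.
Proof. by case. Qed.

Lemma superjet_le w w' z0 p X t :
  (\forall z \near z0, w z <= w' z)%E -> (w' z0 <= w z0)%E ->
  superjet w' z0 p X t -> superjet w z0 p X t.
Proof.
move=> ww' w'w [sX H]; split=> // e /H; apply: filterS2 ww' => z wz /=.
by move=> w'z; apply: le_trans wz _; apply: le_trans w'z _; exact: leeD.
Qed.

Lemma superjet_shift w b z0 p X t :
  (\forall z \near z0, w z <= w z0 + (b z - b z0)%:E)%E ->
  superjet (EFin \o b) z0 p X t -> superjet w z0 p X t.
Proof.
move=> wb [sX H]; split=> // e /H; apply: filterS2 wb => z wz /=.
rewrite lee_fin -lerBlDl => bz; apply: le_trans wz _.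
by apply: leeD => //; rewrite lee_fin.
Qed.

Lemma superjetD b g z0 p X t p' X' t' :
  superjet (EFin \o b) z0 p X t -> superjet (EFin \o g) z0 p' X' t' ->
  superjet (EFin \o (fun z => b z + g z)) z0 (p + p') (X + X') (t + t').
Proof.
move=> [sX Hb] [sX' Hg]; split=> [|e e0]; first by rewrite linearD/= sX sX'.
have e20 : 0 < e / 2 by rewrite divr_gt0.
have := Hg _ e20; apply: filterS2 (Hb _ e20) => z /=; rewrite !lee_fin.
rewrite -!/(qform _ _) qformDl dotvDl; lra.
Qed.

Lemma superjet_quad z0 k p X t c z1 : X^T = X ->
  superjet (EFin \o (fun z => quad z0 k p X t 0 z + c * (z.2 - z0.2) ^+ 2)) z1
    (p + (z1.1 - z0.1) *m X) X (t + 2 * c * (z1.2 - z0.2)).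
Proof.
move=> sX; split=> // e e0; apply/nbhs_boxP.
exists (e / (`|c| + 1)) => [|z _ zs] /=; first by rewrite divr_gt0// ltr_wpDl.
rewrite lee_fin /quad -/(qform _ _) !mul0r !subr0.
have -> : z.1 - z0.1 = (z1.1 - z0.1) + (z.1 - z1.1) by rewrite [RHS]addrC addrA subrK.
rewrite qformD// dotvDl dotvDr.
have -> : z.2 - z0.2 = (z1.2 - z0.2) + (z.2 - z1.2) by rewrite [RHS]addrC addrA subrK.
set s := z.2 - z1.2 in zs *.
have : c * s ^+ 2 <= e * `|s|.
  apply: (@le_trans _ _ (`|c| * `|s| * `|s|)).
    by rewrite -mulrA -expr2 real_normK ?num_real// ler_wpM2r ?sqr_ge0// ler_norm.
  rewrite ler_wpM2r//; move: zs; rewrite ltr_pdivlMr ?ltr_wpDl//.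
  by have := normr_ge0 s; have := normr_ge0 c; nra.
have : 0 <= e * enorm (z.1 - z1.1) ^+ 2 by rewrite mulr_ge0 ?sqr_ge0// ltW.
by nra.
Qed.

(** Moving along a line in space, then backwards in time, isolates the entries
    of the jet. On the crease only a bound on the time slope survives, which is
    all that a subsolution needs. *)
Lemma superjet_quad_inv z0 k p X t c z1 p' X' t' : X^T = X -> 0 <= c ->
  superjet (EFin \o quad z0 k p X t c) z1 p' X' t' ->
  [/\ p' = p + (z1.1 - z0.1) *m X, (forall h, qform X h <= qform X' h)
    & t' <= t + c].
Proof.
move=> sX c0 /superjetP[sX' H].
have Hx e : 0 < e -> forall h, exists2 d : R, 0 < d & forall l : R, `|l| < d ->
    l * dotv (p + (z1.1 - z0.1) *m X) h + 2^-1 * (l ^+ 2 * qform X h) <=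
    l * dotv p' h + 2^-1 * (l ^+ 2 * qform X' h) + e * l ^+ 2 * enorm h ^+ 2.
  move=> e0 h; have [d d0 Hd] := H e e0.
  exists (d / (enorm h + 1)) => [|l ld]; first by rewrite divr_gt0// ltr_wpDl// enorm_ge0.
  have := Hd (z1.1 + l *: h, z1.2); rewrite /= [z1.1 + _ - z1.1]addrAC !subrr add0r normr0 enormZ.
  have -> : `|l| * enorm h < d.
    move: ld; rewrite ltr_pdivlMr ?ltr_wpDl// ?enorm_ge0//.
    by have := normr_ge0 l; have := enorm_ge0 h; lra.
  move=> /(_ isT d0); rewrite lee_fin /quad/= subrr !mul0r !mulr0.
  have -> : z1.1 + l *: h - z1.1 = l *: h by rewrite addrAC subrr add0r.
  have -> : z1.1 + l *: h - z0.1 = z1.1 - z0.1 + l *: h by rewrite addrAC.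
  rewrite qformD// dotvDr dotvDl !dotvZr !qformZr exprMn real_normK ?num_real//.
  clear; lra.
have pE : p' = p + (z1.1 - z0.1) *m X.
  set P := p + _ in Hx *; apply/eqP; rewrite eq_sym -subr_eq0 -dotv_eq0.
  apply: contrapT => /negP q0; pose h := P - p'.
  (* test in the direction of the defect itself *)
  have [d d0 Hd] := Hx 1 ltr01 h.
  have hh : 0 < dotv h h by rewrite lt_neqAle dotv_ge0 eq_sym q0.
  pose C := 2^-1 * (qform X' h - qform X h) + enorm h ^+ 2.
  pose l := Num.min (d / 2) (dotv h h / 2 / (`|C| + 1)).
  have C1 : 0 < `|C| + 1 by rewrite ltr_wpDl.
  have l0 : 0 < l by rewrite lt_min !divr_gt0.
  have ld : `|l| < d by rewrite gtr0_norm// gt_min; apply/orP; left; lra.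
  have lC : l * (`|C| + 1) <= dotv h h / 2 by rewrite -ler_pdivlMr// ge_min lexx orbT.
  have H1 : l * dotv h h <= l * (l * C).
    have := Hd l ld; rewrite {1}/h dotvBl /C; lra.
  move: H1; rewrite ler_pM2l// => H1.
  have : l * C <= l * `|C| by rewrite ler_pM2l// ler_norm.
  by lra.
split=> // [h|].
  apply/ler_addgt0Pr => e e0.
  have e20 : 0 < e / 2 / (enorm h ^+ 2 + 1) by rewrite !divr_gt0// ltr_wpDl// sqr_ge0.
  have [d d0 Hd] := Hx _ e20 h.
  have d2d : `|d / 2| < d by rewrite gtr0_norm ?divr_gt0//; lra.
  have := Hd (d / 2) d2d; rewrite pE; set l := d / 2 => Hl.
  have l2 : 0 < l ^+ 2 by rewrite exprn_gt0// divr_gt0.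
  have He : e / 2 / (enorm h ^+ 2 + 1) * enorm h ^+ 2 <= e / 2.
    by rewrite mulrAC ler_pdivrMr ?ltr_wpDl ?sqr_ge0// ler_pM2l ?divr_gt0// lerDl.
  have He' := ler_wpM2l (ltW l2) He; rewrite -(ler_pM2l l2).
  move: Hl He'; set E := e / 2 / _; clear; lra.
apply/ler_addgt0Pr => e e0.
have [d d0 Hd] := H e e0.
have d2d : `|z1.2 - d / 2 - z1.2| < d.
  by rewrite addrAC subrr add0r normrN gtr0_norm ?divr_gt0//; lra.
have := Hd (z1.1, z1.2 - d / 2); rewrite /= subrr enorm0 => /(_ d0 d2d).
rewrite lee_fin quad0E /quad/= subrr dotv0 qform0 expr0n/=.
rewrite [z1.2 - _ - z1.2]addrAC subrr add0r normrN (gtr0_norm (_ : 0 < d / 2)) ?divr_gt0//.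
have : `|z1.2 - d / 2 - z0.2| <= `|z1.2 - z0.2| + d / 2.
  rewrite addrAC; apply: le_trans (ler_normB _ _) _; rewrite (gtr0_norm (_ : 0 < d / 2))// divr_gt0//.
move=> /(ler_wpM2l c0).
have d20 : 0 < d / 2 by rewrite divr_gt0.
move=> h1 h2; rewrite -(ler_pM2l d20); clear -h1 h2; lra.
Qed.

(** The error terms of the chain rule: [q] is the linear part of the increment
    [y], so that [y - q], hence the mixed and cubic terms, are negligible with
    respect to the parabolic gauge [r]. *)
Lemma chain_rule_bound l m K P M e r d e1 a y q T :
  0 <= l -> 0 <= m -> 0 <= K -> 0 <= P -> 0 <= M -> 0 <= e1 -> 0 <= a ->
  a <= d -> r <= 2 * d -> r <= 1 -> a ^+ 2 <= r ->
  `|q| <= P * a -> `|y - q| <= M * r -> y = T + e1 * r -> l * e1 <= e / 2 ->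
  (m * (P * M + M ^+ 2) + 2 * K * (P + 2 * M) * (P ^+ 2 + M ^+ 2)) * d <= e / 2 ->
  l * y + 2^-1 * m * y ^+ 2 + K * `|y| ^+ 3 <= l * T + 2^-1 * m * q ^+ 2 + e * r.
Proof.
move=> l0 m0 K0 P0 M0 e10 a0 ad rd r1 ar qa yq yE le1 Nd.
have d0 : 0 <= d by exact: le_trans ad.
have r0 : 0 <= r by apply: le_trans ar; rewrite sqr_ge0.
have qd : `|q| <= P * d by apply: le_trans qa _; rewrite ler_wpM2l.
pose u := y - q; have yqu : y = q + u by rewrite /u addrC subrK.
have ur : `|u| <= M * r by [].
have Mr0 : 0 <= M * r by rewrite mulr_ge0.
have yd : `|y| <= (P + 2 * M) * d.
  rewrite yqu; apply: le_trans (ler_normD _ _) _.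
  have Mrd : M * r <= M * (2 * d) by rewrite ler_wpM2l.
  clear -Mrd ur qd; lra.
have u2 : u ^+ 2 <= M ^+ 2 * r ^+ 2.
  by rewrite -exprMn -real_normK ?num_real// ler_pXn2r// nnegrE.
have q2 : q ^+ 2 <= P ^+ 2 * r.
  apply: (@le_trans _ _ ((P * a) ^+ 2)); last by rewrite exprMn ler_wpM2l ?sqr_ge0.
  by rewrite -real_normK ?num_real// ler_pXn2r// nnegrE mulr_ge0.
have r2 : r ^+ 2 <= 2 * d * r by rewrite expr2 ler_wpM2r.
have r2' : r ^+ 2 <= r by rewrite expr2 ler_piMl.
have qu : q * u <= P * d * (M * r).
  by apply: le_trans (ler_norm _) _; rewrite normrM ler_pM.
have y2 : y ^+ 2 - q ^+ 2 <= 2 * (P * M + M ^+ 2) * d * r.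
  have h : M ^+ 2 * r ^+ 2 <= M ^+ 2 * (2 * d * r) by rewrite ler_wpM2l ?sqr_ge0.
  by rewrite yqu; clear -h u2 qu; lra.
have y2' : y ^+ 2 <= 2 * (P ^+ 2 + M ^+ 2) * r.
  have h1 : M ^+ 2 * r ^+ 2 <= M ^+ 2 * r by rewrite ler_wpM2l ?sqr_ge0.
  have h2 : 0 <= (q - u) ^+ 2 by rewrite sqr_ge0.
  by rewrite yqu; clear -h1 h2 u2 q2; lra.
have y3 : `|y| ^+ 3 <= (P + 2 * M) * d * (2 * (P ^+ 2 + M ^+ 2) * r).
  by rewrite exprS real_normK ?num_real// ler_pM ?sqr_ge0.
have h1 : 2^-1 * m * (y ^+ 2 - q ^+ 2) <= 2^-1 * m * (2 * (P * M + M ^+ 2) * d * r).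
  by rewrite ler_wpM2l// mulr_ge0.
have h2 : K * `|y| ^+ 3 <= K * ((P + 2 * M) * d * (2 * (P ^+ 2 + M ^+ 2) * r)).
  by rewrite ler_wpM2l.
have h3 : l * e1 * r <= e / 2 * r by rewrite ler_wpM2r.
have h4 := ler_wpM2r r0 Nd.
rewrite {1}yE; clear -h1 h2 h3 h4; lra.
Qed.

(** Chain rule: [h] is only compared with a second order expansion, hence it
    may be a truncated power, or fail to be defined far away. *)
Lemma superjet_chain w g z0 p X t (h : R -> R) (l m K d : R) :
  superjet (EFin \o g) z0 p X t ->
  0 <= l -> 0 <= m -> 0 <= K -> 0 < d ->
  (forall x y, x <= y -> y <= d -> h x <= h y) ->
  (forall q, `|q| <= d -> h q <= l * q + 2^-1 * m * q ^+ 2 + K * `|q| ^+ 3) ->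
  (\forall z \near z0, (w z <= w z0 + (h (g z - g z0))%:E)%E) ->
  superjet w z0 (l *: p) (l *: X + m *: (p^T *m p)) (l * t).
Proof.
move=> /superjetP[sX Hg] l0 m0 K0 d0 hmono htay /nbhs_boxP[dw dw0 Hw].
apply/superjetP; split=> [|e e0].
  by rewrite linearD/= !linearZ/= trmx_mul trmxK sX.
have [Q Q0 HQ] := ler_quad X 0.
pose M := `|t| + Q + 1; pose P := enorm p.
have P0 : 0 <= P by exact: enorm_ge0.
have M1 : 1 <= M by rewrite /M lerDr addr_ge0.
have M0 : 0 <= M by exact: le_trans M1.
pose e1 := Num.min 1 (e / 2 / (l + 1)).
have e10 : 0 < e1 by rewrite lt_min ltr01 !divr_gt0// ltr_wpDl.
have e11 : e1 <= 1 by rewrite ge_min lexx.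
have le1 : l * e1 <= e / 2.
  have : e1 * (l + 1) <= e / 2 by rewrite -ler_pdivlMr ?ltr_wpDl// ge_min lexx orbT.
  by move: e10; lra.
have [d1 d10 Hd1] := Hg e1 e10.
pose N := m * (P * M + M ^+ 2) + 2 * K * (P + 2 * M) * (P ^+ 2 + M ^+ 2).
have N0 : 0 <= N by rewrite /N addr_ge0 ?mulr_ge0 ?addr_ge0 ?mulr_ge0 ?exprn_ge0.
pose d2 := Num.min (Num.min 2^-1 (Num.min dw d1)) (Num.min (d / (P + 2 * M)) (e / 2 / (N + 1))).
have PM0 : 0 < P + 2 * M by lra.
exists d2 => [|z]; first by rewrite !lt_min invr_gt0 ltr0n dw0 d10 !divr_gt0// ltr_wpDl.
rewrite {1 2}/d2 !lt_min => /andP[/andP[h2 /andP[hw h1]] /andP[hP hN]] /andP[/andP[s2 /andP[sw s1]] /andP[sP sN]].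
apply: le_trans (Hw _ hw sw) _; rewrite leeD2l// lee_fin.
have := Hd1 _ h1 s1; rewrite lee_fin -lerBlDl !quad0E.
rewrite qformDl !qformZl qform_outer dotvZl -/P.
pose dd := Num.max (enorm (z.1 - z0.1)) `|z.2 - z0.2|.
have ad : enorm (z.1 - z0.1) <= dd by rewrite le_max lexx.
have sd : `|z.2 - z0.2| <= dd by rewrite le_max lexx orbT.
have dd2 : dd < 2^-1 by rewrite gt_max h2.
have ddP : dd * (P + 2 * M) <= d by rewrite -ler_pdivlMr// ge_max !ltW.
have ddN : dd * (N + 1) <= e / 2 by rewrite -ler_pdivlMr ?ltr_wpDl// ge_max !ltW.
clear h2 hw h1 hP hN s2 sw s1 sP sN; clearbody dd d2.
have ph : `|dotv p (z.1 - z0.1)| <= P * enorm (z.1 - z0.1) by exact: ler_dotv.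
have XH : `|qform X (z.1 - z0.1)| <= Q * enorm (z.1 - z0.1) ^+ 2 by exact: HQ.
have a0 := enorm_ge0 (z.1 - z0.1); have s0 := normr_ge0 (z.2 - z0.2).
have tsa : `|t * (z.2 - z0.2)| = `|t| * `|z.2 - z0.2| by rewrite normrM.
move: ad sd ph XH a0 s0 tsa.
move: (enorm _) (dotv p _) (qform X _) => a q x.
move: (z.2 - z0.2) => s ad sd ph XH a0 s0 tsa.
set r := `|s| + a ^+ 2; set T := _ + 2^-1 * x => gy.
have dd0 : 0 <= dd by exact: le_trans ad.
have aa : a ^+ 2 <= dd by rewrite expr2; apply: le_trans (ler_pM a0 a0 ad ad) _; nra.
have r0 : 0 <= r by rewrite addr_ge0// sqr_ge0.
have ar : a ^+ 2 <= r by rewrite lerDr.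
have rd : r <= 2 * dd by rewrite /r; lra.
have r1 : r <= 1 by lra.
have yq : `|T + e1 * r - q| <= M * r.
  rewrite (_ : _ - q = t * s + (2^-1 * x + e1 * r)); last by rewrite /T; ring.
  apply: le_trans (ler_normD _ _) _; rewrite tsa.
  have : `|2^-1 * x + e1 * r| <= Q * a ^+ 2 + r.
    apply: le_trans (ler_normD _ _) _; rewrite normrM gtr0_norm//.
    rewrite (@ger0_norm _ (e1 * r)); last by rewrite mulr_ge0// ltW.
    apply: lerD; last by rewrite ler_piMl.
    by have := normr_ge0 x; lra.
  have : `|t| * `|s| <= `|t| * r by rewrite ler_wpM2l// lerDl sqr_ge0.
  have : Q * a ^+ 2 <= Q * r by rewrite ler_wpM2l.
  rewrite /M; lra.
have Nd : N * dd <= e / 2.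
  by move: ddN dd0; clear; lra.
have yd : `|T + e1 * r| <= d.

  have : P * a <= P * dd by rewrite ler_wpM2l.
  have : M * r <= M * (2 * dd) by rewrite ler_wpM2l.
  have : `|T + e1 * r| <= `|q| + `|T + e1 * r - q|.
    by rewrite -{1}[T + e1 * r](subrK q) addrC; exact: ler_normD.
  lra.
apply: le_trans (hmono _ _ gy (le_trans (ler_norm _) yd)) _.
apply: le_trans (htay _ yd) _.
apply: le_trans (chain_rule_bound l0 m0 K0 P0 M0 (ltW e10) a0 ad rd r1 ar ph yq erefl le1 Nd) _.
by rewrite /T; lra.
Qed.

End Jets.

(** * Maximum principles *)
Section Maximum.
Context {R : realType}.

Definition usc_on {T : topologicalType} (C : set T) (g : T -> \bar R) :=
  forall z a, C z -> (g z < a)%E -> \forall z' \near z, (g z' < a)%E.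

(** The superlevel sets generate a filter on [C]; upper semicontinuity makes any
    cluster point of it a maximum. *)
Lemma usc_compact_max {T : topologicalType} (C : set T) (g : T -> \bar R) z0 :
  compact C -> C z0 -> usc_on C g ->
  exists2 z1, C z1 & forall z, C z -> (g z <= g z1)%E.
Proof.
move=> cC Cz0 ug; apply: contrapT => H.
have {}H z : C z -> exists2 z', C z' & (g z < g z')%E.
  move=> Cz; apply: contrapT => H'; apply: H; exists z => // z' Cz'.
  by rewrite leNgt; apply/negP => ?; apply: H'; exists z'.
pose F : set_system T :=
  [set P | exists2 a, C a & forall z, C z -> (g a <= g z)%E -> P z].
have FF : ProperFilter F.
  split; first by move=> [a Ca /(_ _ Ca (lexx _))].
  split; first by exists z0.
  - move=> P Q [a Ca aP] [b Cb bQ].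
    by case/orP: (le_total (g a) (g b)) => ab; [exists b|exists a] => // z Cz zz;
      split; [apply: aP|apply: bQ|apply: aP|apply: bQ] => //; apply: le_trans zz.
  - by move=> P Q PQ [a Ca aP]; exists a => // z Cz /(aP _ Cz) /PQ.
have FC : F C by exists z0.
have [p [Cp clp]] := cC F FF FC.
have [q Cq pq] := H p Cp.
have Fq : F [set z | g q <= g z]%E by exists q.
have [z [/= qz]] := clp _ _ Fq (ug _ _ Cp pq).
by rewrite ltNge qz.
Qed.

Lemma usc_onB {T : topologicalType} (C : set T) (g : T -> \bar R) (b : T -> R) :
  usc_on C g -> (forall z, C z -> {for z, continuous b}) ->
  usc_on C (fun z => g z - (b z)%:E)%E.
Proof.
move=> ug cb z a Cz; case: a => [a| |] //.
- rewrite lteBlDr// => gab.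
  have [r [gr ra]] : exists r : R, (g z < r%:E)%E /\ r < a + b z.
    case: (g z) gab => [x| |]//; last by move=> _; exists (a + b z - 1); rewrite ltNyr gtrBl.
    by rewrite -EFinD lte_fin => h; exists ((x + (a + b z)) / 2); rewrite lte_fin; lra.
  have /(cb z Cz) : nbhs (b z) [set y | r < a + y].
    apply: open_nbhs_nbhs; split => //=.
    rewrite (_ : [set _ | _] = [set y | y > r - a]); first exact: open_gt.
    by apply/seteqP; split => y /=; rewrite ltrBlDl.
  rewrite nbhs_simpl /=; apply: filterS2 (ug _ _ Cz gr) => z' gz' /= rz'.
  change (g z' - (b z')%:E < a%:E)%E; rewrite lteBlDr// -EFinD.
  by apply: lt_trans gz' _; rewrite lte_fin.
- move=> gy; have {gy}: (g z < +oo)%E by case: (g z) gy => [r| |] //=; rewrite ?ltry ?ltNyr ?ltxx.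
  by move=> /(ug _ _ Cz); apply: filterS => z'; case: (g z') => [r| |] //=; rewrite ?ltry ?ltNyr ?ltxx.
- by rewrite ltNge leNye.
Qed.

End Maximum.

Section Touching.
Context {R : realType} {n : nat}.
Local Notation V := 'rV[R]_n.
Implicit Types (p h : V) (X Y : 'M[R]_n) (z : V * R) (w : V * R -> \bar R)
  (b g : V * R -> R) (t k e : R).

Lemma superjet_time_penalty k m t0 z1 : 0 <= m ->
  superjet (EFin \o (fun z : V * R => k * z.2 + m * (Num.max 0 (z.2 - t0)) ^+ 2)) z1
    0 0 (k + 2 * m * Num.max 0 (z1.2 - t0)).
Proof.
move=> m0; split=> [|e e0]; first by rewrite trmx0.
apply/nbhs_boxP; exists (e / (m + 1)) => [|z _ zs] /=; first by rewrite divr_gt0// ltr_wpDl.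
rewrite lee_fin mulmx0 !dot0v.
have -> : z.2 - t0 = (z1.2 - t0) + (z.2 - z1.2) by rewrite [RHS]addrC addrA subrK.
have -> : k * z.2 = k * z1.2 + k * (z.2 - z1.2) by ring.
move: (z.2 - z1.2) (z1.2 - t0) zs => s a zs.
have ms : m * s ^+ 2 <= e * `|s|.
  rewrite -real_normK ?num_real// expr2 mulrA ler_wpM2r//.
  move: zs; rewrite ltr_pdivlMr ?ltr_wpDl// => h; have := normr_ge0 s; clear -h; lra.
have : 0 <= e * enorm (z.1 - z1.1) ^+ 2 by rewrite mulr_ge0 ?sqr_ge0// ltW.
suff h : m * Num.max 0 (a + s) ^+ 2 <= m * (Num.max 0 a + s) ^+ 2.
  by clear -ms h; lra.
rewrite ler_wpM2l//; case: (leP 0 (a + s)) => as0; last by rewrite expr0n/= sqr_ge0.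
by case: (leP 0 a) => a0//; rewrite add0r ler_pXn2r// ?nnegrE//; lra.
Qed.

(** If [w] exceeds a barrier [b], then some superjet of [w] is that of [b] at the
    same point, with a strictly larger time slope: maximise [w - b] minus a
    penalty which increases in time and forbids the terminal time. *)
Lemma touching w b (C : set (V * R)) (T M : R) z0 :
  compact C -> usc_on C w -> continuous b ->
  (forall z, C z -> 0 <= z.2 <= T) ->
  (forall z, C z -> w z <= (b z + M)%:E)%E ->
  C z0 -> z0.2 < T -> ((b z0)%:E < w z0)%E ->
  (forall z, C z -> z.2 < T -> ((b z)%:E < w z)%E -> nbhs z C) ->
  exists z1 k, [/\ 0 < k, C z1, ((b z1)%:E < w z1)%E, nbhs z1 C &
    forall p X t, superjet (EFin \o b) z1 p X t -> superjet w z1 p X (t + k)].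
Proof.
move=> cC uw cb CT wM Cz0 z0T bw Cin.
have [d d0 bd] : exists2 d : R, 0 < d & ((b z0 + d)%:E <= w z0)%E.
  move: bw (wM _ Cz0); case: (w z0) => [r| |]//; rewrite lte_fin => br _.
  by exists (r - b z0); [rewrite subr_gt0|rewrite subrKC].
have [t00 t0T] := andP (CT _ Cz0).
have T0 : 0 < T by exact: le_lt_trans z0T.
(* [k] is small enough to keep [z0] above the barrier; [m] makes the penalty
   reach [M] at time [T] *)
pose k := d / 2 / T; have k0 : 0 < k by rewrite !divr_gt0.
pose m := `|M| / (T - z0.2) ^+ 2.
have Tz : 0 < (T - z0.2) ^+ 2 by rewrite exprn_gt0// subr_gt0.
have m0 : 0 <= m by rewrite divr_ge0// ltW.
pose P z := k * z.2 + m * (Num.max 0 (z.2 - z0.2)) ^+ 2.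
have cP : continuous (P : V * R -> R).
  pose Q (s : R) : R := k * s + m * (Num.max 0 (s - z0.2)) ^+ 2.
  have cQ : continuous Q.
    move=> s; apply: cvgD; first by apply: cvgMr; exact: cvg_id.
    apply: cvgMr; apply: (@continuous_comp _ _ _ (fun s => Num.max 0 (s - z0.2)) (fun s => s ^+ 2)); last exact: exprn_continuous.
    apply: continuous_max; first exact: cvg_cst.
    by apply: cvgB; [exact: cvg_id|exact: cvg_cst].
  by move=> z; apply: (@continuous_comp _ _ _ snd Q); [exact: cvg_snd|exact: cQ].
have [z1 Cz1 z1max] := @usc_compact_max R _ C (fun z => w z - (b z + P z)%:E)%E z0 cC Cz0
   (usc_onB uw (fun z _ => cvgD (cb z) (cP z))).
have P0 : P z0 <= d / 2.
  rewrite /P subrr maxxx expr0n/= mulr0 addr0 /k mulrAC ler_pdivrMr// ler_pM2l//; lra.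
have [r1 wz1 r1b] : exists2 r1 : R, w z1 = r1%:E & b z1 + P z1 + d / 2 <= r1.
  have : ((d / 2)%:E <= w z1 - (b z1 + P z1)%:E)%E.
    apply: le_trans (z1max _ Cz0); rewrite leeBrDr//; apply: le_trans bd.
    rewrite -EFinD lee_fin; lra.
  have := wM _ Cz1; case: (w z1) => [r| |]// _.
  by rewrite -EFinB lee_fin lerBrDl => ?; exists r.
have [z10 z1T] := andP (CT _ Cz1).
have kz1 : 0 <= k * z1.2 by rewrite mulr_ge0// ltW.
have Pz1 : 0 <= P z1 by rewrite addr_ge0// mulr_ge0// sqr_ge0.
have z1ltT : z1.2 < T.
  rewrite lt_neqAle z1T andbT; apply/negP => /eqP z1E.
  have : P z1 >= `|M|.
    have mE : m * (T - z0.2) ^+ 2 = `|M| by rewrite /m divfK ?gt_eqF.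
    by rewrite /P z1E max_r ?subr_ge0// mE lerDr -z1E.
  have := wM _ Cz1; rewrite wz1 lee_fin; have := ler_norm M.
  by clear -r1b d0; lra.
have bw1 : ((b z1)%:E < w z1)%E by rewrite wz1 lte_fin; clear -r1b d0 Pz1; lra.
have nC := Cin _ Cz1 z1ltT bw1.
exists z1, (k + 2 * m * Num.max 0 (z1.2 - z0.2)); split => //.
  have M0 : 0 <= Num.max 0 (z1.2 - z0.2) by rewrite le_max lexx.
  by apply: ltr_wpDr => //; rewrite mulr_ge0// mulr_ge0.
move=> p X t jb; have jP := superjet_time_penalty k z0.2 z1 m0.
have := superjetD jb jP; rewrite !addr0; apply: superjet_shift.
apply: filterS nC => z /z1max; rewrite wz1 -EFinB -/(P _) -/(P _).
rewrite leeBlDr// -EFinD => /le_trans; apply; rewrite lee_fin; clear; lra.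
Qed.

End Touching.

(** * Comparison with explicit barriers *)
Section Comparison.
Context {R : realType} {n : nat}.
Local Notation V := 'rV[R]_n.
Implicit Types (p h x : V) (X Y : 'M[R]_n) (z : V * R) (w : V * R -> R)
  (b g : V * R -> R) (t k e : R).

Lemma superjet_linear_time k z0 :
  superjet (EFin \o (fun z : V * R => k * z.2)) z0 0 0 k.
Proof.
have := @superjet_time_penalty R n k 0 0 z0 (lexx 0); rewrite mulr0 mul0r addr0.
apply: superjet_shift; apply: near_all => z /=; rewrite lee_fin; lra.
Qed.

Lemma superjet_paraboloid x0 l k c z0 :
  superjet (EFin \o (fun z : V * R => l + c * z.2 + k * enorm (z.1 - x0) ^+ 2)) z0
    ((2 * k) *: (z0.1 - x0)) (2 * k)%:M c.
Proof.
have := @superjet_quad R n (x0, 0) l 0 (2 * k)%:M c 0 z0 (tr_scalar_mx _ _).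
rewrite mulr0 mul0r addr0 add0r mul_mx_scalar; apply: superjet_shift.
apply: near_all => z /=; rewrite lee_fin /quad/= !dot0v !qform_scalar; lra.
Qed.

Lemma continuous_paraboloid x0 l k c :
  continuous (fun z : V * R => l + c * z.2 + k * enorm (z.1 - x0) ^+ 2 : R).
Proof.
move=> z; apply: cvgD.
  by apply: cvgD; [exact: cvg_cst|apply: cvgMr; exact: cvg_snd].
apply: cvgMr; apply: (@continuous_comp _ _ _ (fun z : V * R => enorm (z.1 - x0)) (fun s : R => s ^+ 2)); last exact: exprn_continuous.
by apply: (@continuous_comp _ _ _ fst (fun x : V => enorm (x - x0) : R)); [exact: cvg_fst|exact: enormB_continuous].
Qed.

Lemma truncated_cube_le (a q : R) : (Num.max 0 (a + q)) ^+ 3 <=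
  (Num.max 0 a) ^+ 3 + 3 * (Num.max 0 a) ^+ 2 * q + 3 * Num.max 0 a * q ^+ 2 + `|q| ^+ 3.
Proof.
have q3 : q ^+ 3 <= `|q| ^+ 3 by rewrite -normrX ler_norm.
have q30 : 0 <= `|q| ^+ 3 by rewrite exprn_ge0.
case: (leP 0 a) => a0; case: (leP 0 (a + q)) => aq.
- by clear -q3; lra.
- have q0 : q < 0 by lra.
  rewrite ltr0_norm// expr0n/=.
  have nq : 0 < - q by rewrite oppr_gt0.
  have h1 := exprn_ge0 3 (ltW nq).
  have h2 : 0 <= a * ((a + 3 / 2 * q) ^+ 2 + 3 / 4 * q ^+ 2).
    by rewrite mulr_ge0// addr_ge0 ?sqr_ge0// mulr_ge0 ?sqr_ge0// divr_ge0.
  by clear -h1 h2; lra.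
- have q0 : 0 < q by lra.
  rewrite gtr0_norm// !expr0n/= !mulr0 !mul0r !add0r ler_pXn2r// ?nnegrE ?ltW//; lra.
- by rewrite !expr0n/= !mulr0 !mul0r !add0r.
Qed.

(** The truncated cube of a function with a superjet; the power three makes it
    twice differentiable across the zero level. *)
Lemma superjet_truncated_cube g z0 p X t A : 0 <= A ->
  superjet (EFin \o g) z0 p X t ->
  superjet (EFin \o (fun z => A * (Num.max 0 (g z)) ^+ 3)) z0
    ((3 * A * (Num.max 0 (g z0)) ^+ 2) *: p)
    ((3 * A * (Num.max 0 (g z0)) ^+ 2) *: X
       + (6 * A * Num.max 0 (g z0)) *: (p^T *m p))
    (3 * A * (Num.max 0 (g z0)) ^+ 2 * t).
Proof.
move=> A0 jg; set a := g z0.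
have a0 : 0 <= Num.max 0 a by rewrite le_max lexx.
apply: (@superjet_chain _ _ _ g z0 p X t
  (fun q => A * (Num.max 0 (a + q)) ^+ 3 - A * (Num.max 0 a) ^+ 3) _ _ A 1) => //.
- by rewrite !mulr_ge0// exprn_ge0.
- by rewrite !mulr_ge0.
- have m0 (s : R) : 0 <= Num.max 0 s by rewrite le_max lexx.
  move=> x y xy _; rewrite lerD2r ler_wpM2l// lerXn2r ?nnegrE ?m0//.
  by rewrite ge_max m0/= le_max lerD2l xy orbT.
- move=> q _; have := ler_wpM2l A0 (truncated_cube_le a q); clear; lra.
- apply: near_all => z /=; rewrite /a lee_fin [g z0 + _]addrC subrK; lra.
Qed.

Lemma Hlow0_ge0 : (0 <= Hlow (0 : V) 0)%E.
Proof.
have := Hlow_scalar_ge (0 : V) 0.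
by rewrite mul0r enorm0 subr0 oppr0 (raddf0 (@scalar_mx R n)).
Qed.

Variables (f : V -> R) (c r0 : R).
Hypotheses (c_ge0 : 0 <= c) (f_ge0 : forall x, 0 <= f x) (f_le : forall x, f x <= c)
  (f_supp : forall x, r0 < enorm x -> f x = 0).

Lemma source_env_ge0 x : (0 <= usc_env setT f x)%E.
Proof. by apply: le_trans (usc_env_ge f I); rewrite lee_fin. Qed.

Lemma source_env_le x : (usc_env setT f x <= c%:E)%E.
Proof. by apply: usc_env_le; apply: near_all => y _; rewrite lee_fin. Qed.

Lemma source_env_out x : r0 < enorm x -> (usc_env setT f x <= 0)%E.
Proof.
move=> rx; apply: usc_env_le; apply/nbhs_eballP.
exists (enorm x - r0); first by rewrite subr_gt0.
move=> y yx _; rewrite lee_fin f_supp//.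
have := ler_enormB x y; rewrite enormBC => /(le_trans (ler_norm _)); lra.
Qed.

(** Compact support and the initial condition keep the contact point given by
    [touching] away from the parabolic boundary. At that point the strict gain
    of time slope contradicts the barrier inequality. *)
Lemma comparison w b T :
  is_subsolution f (fun=> 0) w -> compactly_supported w -> 0 < T ->
  continuous b -> (forall z, 0 <= z.2 -> 0 <= b z) ->
  (forall z, 0 < z.2 < T -> exists p X t, superjet (EFin \o b) z p X t /\
     (usc_env setT f z.1 <= t%:E + Hlow p X)%E) ->
  forall z, 0 <= z.2 < T -> w z <= b z.
Proof.
move=> [lw w0 sw] csw T0 cb b0 Hb z0 /andP[z00 z0T]; rewrite leNgt; apply/negP => bw.
have [r rp Hr] := csw T T0.
have Hr0 z : r <= enorm z.1 -> 0 <= z.2 <= T -> w z = 0.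
  by case: z => x t /= rx; apply: Hr; rewrite /eball/= subr0 ltNge rx.
pose C : set (V * R) := [set y | enorm (y - 0) <= r + 1] `*` `[0, T]%classic.
have CT z : C z -> 0 <= z.2 <= T by case=> _ /=; rewrite in_itv.
have cC : compact C by exact: compact_box.
have Cz0 : C z0.
  split => /=; last by rewrite in_itv/= z00 ltW.
  rewrite subr0 leNgt; apply/negP => rz; move: bw; rewrite Hr0.
  - by rewrite ltNge b0.
  - by lra.
  - by rewrite z00 ltW.
pose W := usc_env spacetime w.
have uW : usc_on C W by move=> z a _; exact: usc_env_near_lt.
have [z' Cz' Wz'] := usc_compact_max cC Cz0 uW.
have [M WM] : exists M : R, W z' = M%:E.
  by apply: usc_env_fin lw; have /andP[] := CT _ Cz'.
have bW : ((b z0)%:E < W z0)%E by apply: lt_le_trans (usc_env_ge w z00); rewrite lte_fin.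
have Cle z : C z -> (W z <= (b z + `|M|)%:E)%E.
  move=> Cz; apply: le_trans (Wz' _ Cz) _; rewrite WM lee_fin.
  by apply: le_trans (ler_norm M) _; rewrite lerDr b0//; have /andP[] := CT _ Cz.
have Cin z : C z -> z.2 < T -> ((b z)%:E < W z)%E -> nbhs z C.
  move=> Cz zT bWz; have /andP[zp _] := CT _ Cz.
  have z2 : 0 < z.2.
    rewrite lt_neqAle zp andbT; apply/negP => /eqP z20.
    have := w0 z.1; rewrite z20 -surjective_pairing.
    by move=> /(lt_le_trans bWz); rewrite lte_fin -z20 ltNge b0.
  have zr : enorm z.1 < r + 1.
    rewrite ltNge; apply/negP => rz; move: bWz; rewrite ltNge => /negP; apply.
    apply: le_trans (_ : 0%:E <= _)%E; last by rewrite lee_fin b0.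
    apply: usc_env_le; apply/nbhs_boxP; exists (Num.min 1 (T - z.2)).
      by rewrite lt_min ltr01 subr_gt0.
    move=> y; rewrite !lt_min => /andP[y1 _] /andP[_ y2] yp; rewrite lee_fin Hr0//.
      have := ler_enormB z.1 y.1; rewrite enormBC => /(le_trans (ler_norm _)); lra.
    rewrite yp/=; move: y2; rewrite ltr_norml => /andP[_]; lra.
  apply/nbhs_boxP; exists (Num.min (r + 1 - enorm z.1) (Num.min z.2 (T - z.2))).
    by rewrite !lt_min !subr_gt0 zr z2.
  move=> y; rewrite !lt_min => /andP[y1 _] /andP[_ /andP[y2 y3]]; split => /=.
    rewrite subr0; have := ler_enormB y.1 z.1 => /(le_trans (ler_norm _)); lra.
  move: y2 y3; rewrite in_itv/= !ltr_norml => /andP[? _] /andP[_ ?]; apply/andP; split; lra.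
have [z1 [k [k0 Cz1 bW1 nC jets]]] := touching cC uW cb CT Cle Cz0 z0T bW Cin.
have z12 : 0 < z1.2 < T.
  move/nbhs_boxP: nC => [e e0 He].
  have := He (z1.1, z1.2 - e / 2); have := He (z1.1, z1.2 + e / 2) => /=.
  rewrite subrr enorm0.
  have -> : z1.2 + e / 2 - z1.2 = e / 2 by ring.
  have -> : z1.2 - e / 2 - z1.2 = - (e / 2) by ring.
  rewrite normrN gtr0_norm ?divr_gt0//.
  have e2 : e / 2 < e by lra.
  move=> /(_ e0 e2) [_ /=]; rewrite in_itv/= => /andP[_ h1].
  move=> /(_ e0 e2) [_ /=]; rewrite in_itv/= => /andP[h2 _].
  by apply/andP; split; lra.
have [p [X [t [jb fle]]]] := Hb z1 z12.
have /andP[z1p _] := z12.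
have := sw z1 _ _ _ z1p (jets _ _ _ jb); move: fle.
have := source_env_ge0 z1.1; have := source_env_le z1.1.
case: (usc_env setT f z1.1) => [a| |]// _ _.
case: (Hlow p X) => [H| |]//; rewrite -!EFinD !lee_fin; lra.
Qed.

Lemma subsolution_le_linear w :
  is_subsolution f (fun=> 0) w -> compactly_supported w ->
  forall z, 0 <= z.2 -> w z <= c * z.2.
Proof.
move=> sw csw z z0.
have T0 : 0 < z.2 + 1 by lra.
apply: (@comparison w (fun z => c * z.2) _ sw csw T0) => //.
- by move=> y; apply: cvgMr; exact: cvg_snd.
- by move=> y y0; rewrite mulr_ge0.
- move=> y _; exists 0, 0, c; split; first exact: superjet_linear_time.
  apply: le_trans (source_env_le _) _; rewrite leeDl//.
  exact: Hlow0_ge0.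
- by rewrite z0/=; lra.
Qed.

(** The barrier is the truncated cube of [L + B * t - |x|^2]. Its support is a
    ball which grows faster than unit speed, and the source lives where its
    slope is at least [c]. The bound is uniform over all subsolutions. *)
Lemma subsolution_support T : 0 < T -> exists2 r : R, 0 < r &
  forall w, is_subsolution f (fun=> 0) w -> compactly_supported w ->
  forall z, r <= enorm z.1 -> 0 <= z.2 <= T -> w z <= 0.
Proof.
move=> T0; pose S := T + 1.
pose L := r0 ^+ 2 + 1; pose B := 4 * S + 4 * L + 4; pose A := c / 3 + 1.
have S0 : 0 < S by rewrite /S; lra.
have L1 : 1 <= L by rewrite lerDr sqr_ge0.
have A1 : 0 < A by rewrite ltr_wpDl// divr_ge0.
have A0 := ltW A1.
have B0 : 0 < B by rewrite /B; lra.
pose g z : R := L + B * z.2 + -1 * enorm (z.1 - 0) ^+ 2.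
have LB : 1 <= L + B * S + 1 by rewrite lerDr addr_ge0 ?mulr_ge0// ltW//; lra.
exists (L + B * S + 1) => [|w sw csw z rz /andP[z0 zT]].
  exact: lt_le_trans LB.
have gz : g z <= 0.
  have : (L + B * S + 1) ^+ 2 <= enorm z.1 ^+ 2.
    by rewrite ler_pXn2r// nnegrE ?enorm_ge0//; lra.
  have : L + B * S + 1 <= (L + B * S + 1) ^+ 2 by rewrite expr2 ler_peMr//; lra.
  have : B * z.2 <= B * S by rewrite ler_wpM2l// ?ltW// /S; lra.
  rewrite /g subr0; lra.
have zS : 0 <= z.2 < S by rewrite z0/= /S; lra.
apply: le_trans (comparison (b := fun z => A * (Num.max 0 (g z)) ^+ 3) sw csw S0 _ _ _ zS) _.
- move=> y; apply: cvgMr; apply: (@continuous_comp _ _ _ (fun z => Num.max 0 (g z) : R) (fun s : R => s ^+ 3)); last exact: exprn_continuous.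
  apply: continuous_max; first exact: cvg_cst.
  exact: continuous_paraboloid.
- by move=> y _; rewrite mulr_ge0// exprn_ge0// le_max lexx.
- move=> y /andP[y0 yS].
  have jg := superjet_paraboloid 0 L (-1) B y; rewrite subr0 in jg.
  have := superjet_truncated_cube A0 jg.
  set p := _ *: y.1; set X := _%:M; set l := 3 * A * _; set m := 6 * A * _.
  move=> jb; exists (l *: p), (l *: X + m *: (p^T *m p)), (l * B); split=> //.
  have [g0|g0] := leP (g y) 0.
    have l0 : l = 0 by rewrite /l max_l// expr0n/= mulr0.
    have m0 : m = 0 by rewrite /m max_l// mulr0.
    rewrite l0 m0 !scale0r addr0 mul0r add0e.
    apply: le_trans (source_env_out _) _.
      rewrite ltNge; apply/negP => yr.
      have : enorm y.1 ^+ 2 <= r0 ^+ 2.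
        by rewrite ler_pXn2r// nnegrE ?enorm_ge0//; apply: le_trans yr; exact: enorm_ge0.
      have : 0 <= B * y.2 by rewrite mulr_ge0// ltW.
      by move: g0; rewrite /g /L subr0; lra.
    exact: Hlow0_ge0.
  have mE : Num.max 0 (g y) = g y by rewrite max_r// ltW.
  have y2 : enorm y.1 ^+ 2 <= L + B * S.
    have : B * y.2 <= B * S by rewrite ler_wpM2l// ltW.
    by move: g0; rewrite /g subr0; lra.
  (* [B] was chosen so that (B - 3)^2 dominates 4 (L + B S) *)
  have yB : 2 * enorm y.1 + 3 <= B.
    rewrite -lerBrDr -(@ler_pXn2r _ 2)// ?nnegrE ?mulr_ge0 ?enorm_ge0//; last by rewrite /B; lra.
    rewrite exprMn; apply: le_trans (_ : 4 * (L + B * S) <= _); first by rewrite -natrX ler_pM2l.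
    have SL : S <= S * L by rewrite ler_peMr// ltW.
    have LL : 0 <= L * L by rewrite mulr_ge0// (le_trans ler01).
    by rewrite /B; clear -L1 S0 SL LL; lra.
  have l0 : 0 < l by rewrite /l -/(g y) mE !mulr_gt0// exprn_gt0.
  have jH := Hlow_geometric m l0 (Hlow_scalar_ge p (2 * -1)).
  apply: le_trans (_ : l%:E <= _)%E; last first.
    apply: le_trans (leeD2l _ jH); rewrite -EFinD lee_fin.
    rewrite /p enormZ normrM normrN1 mulr1 ger0_norm//.
    have n1 : 0 <= l * n%:R by rewrite mulr_ge0// ltW.
    move: (ler_wpM2l (ltW l0) yB) => yB1.
    clear -n1 l0 yB1; lra.
  have [yr|yr] := leP (enorm y.1) r0; last first.
    by apply: le_trans (source_env_out yr) _; rewrite lee_fin ltW.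
  apply: le_trans (source_env_le _) _; rewrite lee_fin.
  have g1 : 1 <= g y.
    have : enorm y.1 ^+ 2 <= r0 ^+ 2.
      by rewrite ler_pXn2r// nnegrE ?enorm_ge0//; apply: le_trans yr; exact: enorm_ge0.
    have : 0 <= B * y.2 by rewrite mulr_ge0// ltW.
    by rewrite /g /L subr0; clear; lra.
  rewrite /l -/(g y) mE.
  have : 3 * A * 1 <= 3 * A * g y ^+ 2 by rewrite ler_wpM2l ?mulr_ge0// expr_ge1// ltW.
  by apply: le_trans; rewrite /A; lra.
- by rewrite max_l// expr0n/= mulr0.
Qed.

End Comparison.

(** * Perron's method *)
Section Glue.
Context {R : realType} {n : nat}.
Local Notation V := 'rV[R]_n.
Implicit Types (p h x : V) (X Y : 'M[R]_n) (z : V * R) (w : V * R -> R)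
  (f v : V -> R) (t k e : R).

Lemma locally_boundedP {T : topologicalType} (D : set T) (g : T -> R) :
  locally_bounded D g <-> forall z : T, D z -> exists M : R,
    \forall z' \near z, D z' -> `|g z'| <= M.
Proof.
split=> H z /H.
  move=> [M [_ /(_ (M + 1))]]; rewrite ltrDl ltr01 => /(_ isT) ?.
  by exists (M + 1).
move=> [M HM]; exists M; split; first exact: num_real.
move=> N MN; rewrite /prop_near1/within/=; apply: filterS HM => z' H' /H' /le_trans.
by apply; exact: ltW.
Qed.

Lemma continuous_bounded_near {T : topologicalType} (g : T -> R) (z : T) :
  {for z, continuous g} -> \forall z' \near z, `|g z'| <= `|g z| + 1.
Proof.
move=> /(_ _ (nbhsx_ballx _ _ ltr01)); rewrite nbhs_simpl /=; apply: filterS => z'.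
rewrite /ball/= => gz; rewrite -[g z'](subrK (g z)) addrC; apply: le_trans (ler_normD _ _) _.
by rewrite lerD2l distrC ltW.
Qed.

Lemma near_positive z : 0 < z.2 -> nbhs z [set y : V * R | 0 < y.2].
Proof.
move=> z0; apply/nbhs_boxP; exists z.2 => // y _.
by rewrite ltr_norml /= => /andP[+ _]; rewrite ltrBrDr addrC subrr.
Qed.

Definition gluemax (C : set (V * R)) w (g : V * R -> R) : V * R -> R :=
  fun z => if `[< C z >] then Num.max (w z) (g z) else w z.

Lemma gluemax_ge C w g z : w z <= gluemax C w g z.
Proof. by rewrite /gluemax; case: asboolP => // _; rewrite le_max lexx. Qed.

Lemma gluemax_ger C w g z : C z -> g z <= gluemax C w g z.
Proof. by move=> Cz; rewrite /gluemax; case: asboolP => // _; rewrite le_max lexx orbT. Qed.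

(** A superjet of the maximum is one of whichever function realises it. The set
    [D] separates the contact region of [g] from the boundary of [C], where
    restricting [g] to [C] would create spurious superjets. *)
Lemma gluemax_subsolution f v w g (C D : set (V * R)) :
  is_subsolution f v w -> continuous g -> closed C -> open D -> D `<=` C ->
  (forall z, C z -> 0 <= z.2 -> w z < g z -> D z) ->
  (forall z, D z -> 0 < z.2) ->
  (forall z p X t, D z -> w z < g z -> superjet (EFin \o g) z p X t ->
    (t%:E + Hlow p X <= usc_env setT f z.1)%E) ->
  is_subsolution f v (gluemax C w g).
Proof.
move=> [lw w0 sw] cg cC oD DC CD D0 sg.
pose W := gluemax C w g.
have wW z : (usc_env spacetime w z <= usc_env spacetime W z)%E.
  by apply: usc_env_le_env; apply: near_all => y _; exact: gluemax_ge.
have gcts z e : 0 < e -> \forall y \near z, g y < g z + e.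
  move=> e0; have := cg z _ (nbhsx_ballx _ _ e0); rewrite nbhs_simpl /=; apply: filterS => y /=.
  by rewrite /ball/= ltr_distlC => /andP[].
have Wmax z : (usc_env spacetime W z <= Order.max (usc_env spacetime w z) (g z)%:E)%E.
  rewrite leNgt; apply/negP; rewrite gt_max => /andP[wz gz].
  have [b bW wb] := usc_env_lt_near wz.
  have [r gr rW] : exists2 r : R, g z < r & (r%:E < usc_env spacetime W z)%E.
    case: (usc_env spacetime W z) gz => [a| |]//; last by exists (g z + 1); rewrite ?ltrDl ?ltry.
    by rewrite lte_fin => ga; exists ((g z + a) / 2); rewrite ?lte_fin; lra.
  have : (usc_env spacetime W z <= Order.max b r%:E)%E.
    have e0 : 0 < r - g z by rewrite subr_gt0.
    apply: usc_env_le; apply: filterS2 wb (gcts z _ e0) => y wy; rewrite subrKC => gy ty.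
    rewrite /W /gluemax; case: asboolP => _; last by rewrite le_max wy.
    by rewrite EFin_max ge_max !le_max wy//= lee_fin (ltW gy) orbT.
  by rewrite leNgt gt_max bW rW.
have Wout z : 0 <= z.2 -> ~ D z -> (usc_env spacetime W z <= usc_env spacetime w z)%E.
  move=> z0 nD; have [Cz|nC] := pselect (C z).
    apply: le_trans (Wmax z) _; rewrite ge_max lexx/=.
    apply: le_trans (usc_env_ge w z0); rewrite lee_fin leNgt; apply/negP => wg.
    exact: nD (CD z Cz z0 wg).
  apply: usc_env_le_env; have : nbhs z (~` C) by apply: open_nbhs_nbhs; split=> //; exact: closed_openC.
  by apply: filterS => y nCy _; rewrite /W /gluemax asboolF.
split.
- apply/locally_boundedP => z z0.
  have /locally_boundedP/(_ z z0)[M HM] := lw.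
  exists (M + (`|g z| + 1)); apply: filterS2 HM (continuous_bounded_near (cg z)) => y wM gM y0.
  have := wM y0; have := normr_ge0 (w y); have := normr_ge0 (g y).
  rewrite /W /gluemax; case: asboolP => _; last by move: gM; lra.
  by rewrite maxEle; case: ifP => _; move: gM; lra.
- move=> x; apply: le_trans (w0 x); apply: Wout => /=; first exact: lexx.
  by move=> /D0; rewrite ltxx.
- move=> z p X t z0 jW; rewrite -/W in jW *.
  have [Wz|wWz] := leP (usc_env spacetime W z) (usc_env spacetime w z).
    apply: sw z0 (superjet_le _ Wz jW); exact: near_all.
  have Dz : D z.
    by apply: contrapT => nD; move: wWz; rewrite ltNge Wout// ltW.
  have Wg : (usc_env spacetime W z <= (g z)%:E)%E.
    by have := Wmax z; rewrite le_max leNgt wWz.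
  have wg : w z < g z.
    by rewrite -lte_fin; exact: le_lt_trans (usc_env_ge w (ltW z0)) (lt_le_trans wWz Wg).
  apply: (sg z p X t Dz wg); apply: (superjet_le _ Wg jW).
  have nz := near_positive z0.
  have nD : nbhs z D by apply: open_nbhs_nbhs; split.
  apply: filterS2 nz nD => y /= y0 Dy.
  apply: le_trans (usc_env_ge W (ltW y0)); rewrite lee_fin.
  exact: gluemax_ger (DC _ Dy).
Qed.

Lemma gluemax_support C w g r : 0 < r ->
  compactly_supported w -> (forall z, C z -> enorm z.1 < r) ->
  compactly_supported (gluemax C w g).
Proof.
move=> r0 cw Cr T /cw[s s0 Hs]; exists (Num.max r s) => [|x t]; first by rewrite lt_max r0.
rewrite /eball/= subr0 => /negP; rewrite -leNgt ge_max => /andP[rx sx] tT.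
rewrite /gluemax asboolF; last by move=> /Cr/=; rewrite ltNge rx.
by apply: Hs tT; rewrite /eball/= subr0 ltNge sx.
Qed.

Lemma superjet_const k z p X t : superjet (EFin \o (fun=> k : R)) z p X t ->
  [/\ p = 0, (forall h, 0 <= qform X h) & t <= 0].
Proof.
move=> jk.
have : superjet (EFin \o quad z k 0 0 0 0) z p X t.
  apply: superjet_shift jk; apply: near_all => y.
  by rewrite /quad/= !dot0v !mul0r !subr0 /qform !mulmx0 !dot0v mulr0 !addr0 subrr lee_fin addr0.
move=> /superjet_quad_inv[]//; first by rewrite trmx0.
rewrite mulmx0 addr0 addr0 => -> H ?; split=> // h.
by have := H h; rewrite {1}/qform mulmx0 dot0v.
Qed.

Lemma zero_subsolution (n_gt0 : (0 < n)%N) f : (forall x, 0 <= f x) ->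
  is_subsolution f (fun=> 0) (fun=> 0).
Proof.
move=> f0; have c0 z : {for z, continuous (fun _ : V * R => 0 : R)} by exact: cvg_cst.
split.
- by apply/locally_boundedP => z _; exists 0; apply: near_all => y _; rewrite normr0.
- by move=> x; rewrite env_continuous//; exact: lexx.
- move=> z p X t z0 jz.
  have jz0 : superjet (EFin \o (fun=> 0 : R)) z p X t.
    apply: superjet_le jz; last by rewrite env_continuous//; exact: ltW.
    by have := near_positive z0; apply: filterS => y /= y0; rewrite env_continuous//; exact: ltW.
  have [p0 X0 t0] := superjet_const jz0.
  apply: (@le_trans _ _ 0%E); last exact: source_env_ge0.
  rewrite p0; have sX := superjet_sym jz.
  have : (Hlow (0 : V) X <= 0)%E.
    apply: le_trans (_ : Hlow (0 : V) (0%:M) <= 0)%E.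
      apply: Hlow_mono => //; first by rewrite tr_scalar_mx.
      by move=> h; rewrite qform_scalar mul0r.
    by have := Hlow_scalar_le n_gt0 (0 : V) 0; rewrite mul0r oppr0.
  by move=> H; apply: adde_le0.
Qed.

Lemma dotv_continuous p : continuous (fun x : V => dotv p x : R).
Proof.
rewrite (_ : (fun _ => _) = fun x : V => \sum_i p 0 i * x 0 i); last first.
  by apply/funext => y; rewrite dotvE.
apply: (continuous_big (@add_continuous R)) => i _ y.
by apply: continuousM; [exact: cst_continuous|exact: coord_continuous].
Qed.

Lemma qform_continuous X : continuous (fun x : V => qform X x : R).
Proof.
rewrite (_ : (fun _ => _) =
    fun x : V => \sum_i (\sum_j x 0 j * X j i) * x 0 i); last first.
  by apply/funext => y; rewrite /qform dotvE; apply: eq_bigr => i _; rewrite mxE.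
apply: (continuous_big (@add_continuous R)) => i _ y.
apply: continuousM; last exact: coord_continuous.
apply: (continuous_big (@add_continuous R)) => j _ {}y.
by apply: continuousM; [exact: coord_continuous|exact: cst_continuous].
Qed.

Lemma shift_fst_continuous (g : V -> R) x0 : continuous g ->
  continuous (fun z : V * R => g (z.1 - x0) : R).
Proof.
move=> cg z; apply: (@continuous_comp _ _ _ (fun z : V * R => z.1 - x0) g); last exact: cg.
by apply: cvgB; [exact: cvg_fst|exact: cvg_cst].
Qed.

Lemma shift_snd_continuous (s0 : R) : continuous (fun z : V * R => z.2 - s0 : R).
Proof. by move=> z; apply: cvgB; [exact: cvg_snd|exact: cvg_cst]. Qed.

Lemma quad_continuous z0 k p X t e : continuous (quad z0 k p X t e).
Proof.
move=> z; apply: cvgB; last first.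
  apply: cvgMr; apply: (@continuous_comp _ _ _ (fun z : V * R => z.2 - z0.2) (fun s : R => `|s|)).
    exact: shift_snd_continuous.
  exact: norm_continuous.
apply: cvgD; [apply: cvgD; [apply: cvgD; [exact: cvg_cst|]|]|].
- by apply: cvgMr; exact: shift_snd_continuous.
- exact: (shift_fst_continuous (@dotv_continuous p)).
- by apply: cvgMr; exact: (shift_fst_continuous (@qform_continuous X)).
Qed.

End Glue.

Section Perron.
Context {R : realType} {n : nat}.
Local Notation V := 'rV[R]_n.
Implicit Types (p h x : V) (X Y : 'M[R]_n) (z : V * R) (f v : V -> R) (t k e : R).

Lemma enorm_mulmx X : exists2 K : R, 0 <= K & forall h, enorm (h *m X) <= K * enorm h.
Proof.
have [K K0 HK] := ler_quad (X *m X^T) 0.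
exists (Num.sqrt K) => [|h]; first exact: sqrtr_ge0.
rewrite -(@ler_pXn2r _ 2)// ?nnegrE ?mulr_ge0 ?sqrtr_ge0 ?enorm_ge0//.
rewrite exprMn (sqr_sqrtr K0) -[leLHS]dotvv dotv_mulmx dotvC -mulmxA.
exact: le_trans (ler_norm _) (HK h).
Qed.

(** Maximise [w - phi] for a member [w] of the family almost reaching [W z0].
    The weight [e * |s|] of the semijet is not differentiable, hence it is
    replaced in [phi] by [e / eta * s ^+ 2]: this confines the maximum to
    |s| < 2 eta, where the time slope of [phi] is within 4 e of [t]. *)
Lemma superjet_approx (W : V * R -> \bar R) (F : set (V * R -> \bar R)) (U : set (V * R))
    z0 p X t (a e0 : R) :
  nbhs z0 U -> (forall w, F w -> usc_on setT w) ->
  (forall w z, F w -> U z -> (w z <= W z)%E) ->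
  W z0 = a%:E ->
  (forall e P, 0 < e -> nbhs z0 P ->
     exists w z, [/\ F w, P z & ((a - e)%:E < w z)%E]) ->
  superjet W z0 p X t -> 0 < e0 ->
  exists w z1 p1 e t1, [/\ F w, U z1, superjet w z1 p1 (X + (4 * e)%:M) t1
    & [/\ 0 < e < e0, enorm (z1.1 - z0.1) < e0, enorm (p1 - p) < e0 & t - e0 <= t1]].
Proof.
move=> /nbhs_boxP[dU dU0 HU] uF FW W0 Happ /superjetP[sX HW] e00.
pose e := Num.min 1 (e0 / 8).
have ep : 0 < e by rewrite lt_min ltr01 divr_gt0.
have e8 : e * 8 <= e0 by rewrite -ler_pdivlMr// ge_min lexx orbT.
have [d d0 Hd] := HW e ep.
pose Y := X + (4 * e)%:M.
have sY : Y^T = Y by rewrite linearD/= tr_scalar_mx sX.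
have [K K0 HK] := enorm_mulmx Y.
pose q := Num.min (Num.min 1 (d / 2)) (Num.min (dU / 2) (e0 / 2 / (K + 1))).
have q0 : 0 < q by rewrite !lt_min ltr01 !divr_gt0// ltr_wpDl.
have q1 : q <= 1 by rewrite !ge_min lexx.
have qd : q < d.
  by apply: (@le_lt_trans _ _ (d / 2)); [rewrite !ge_min lexx !orbT|lra].
have qU : q < dU.
  by apply: (@le_lt_trans _ _ (dU / 2)); [rewrite !ge_min lexx !orbT|lra].
have qK : q * (K + 1) <= e0 / 2.
  by rewrite -ler_pdivlMr ?ltr_wpDl// !ge_min lexx !orbT.
pose eta := q ^+ 2 / 4.
have eta0 : 0 < eta by rewrite divr_gt0// exprn_gt0.
have eta_q : 2 * eta < q ^+ 2 by rewrite /eta; have := exprn_gt0 2 q0; clear; lra.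
have qq : q ^+ 2 <= q by rewrite expr2 ger_pMr.
pose c := e / eta; have c0 : 0 < c by rewrite divr_gt0.
pose phi z := quad z0 0 p Y t 0 z + c * (z.2 - z0.2) ^+ 2.
have cphi : continuous phi.
  move=> z; apply: cvgD; first exact: quad_continuous.
  apply: cvgMr; apply: (@continuous_comp _ _ _ (fun z : V * R => z.2 - z0.2) (fun s : R => s ^+ 2)); last exact: exprn_continuous.
  exact: shift_snd_continuous.
have phi0 : phi z0 = 0.
  by rewrite /phi quad0E !subrr dotv0 qform0 mulr0 expr0n/= !mulr0 !addr0.
have phiE z : phi z = quad z0 0 p X t 0 z + 2 * e * enorm (z.1 - z0.1) ^+ 2 + c * (z.2 - z0.2) ^+ 2.
  by rewrite /phi !quad0E qformDl qform_scalar; clear; lra.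
pose C : set (V * R) := [set y | enorm (y - z0.1) <= q] `*` `[z0.2 - q, z0.2 + q]%classic.
have cC : compact C by exact: compact_box.
have CP z : C z <-> enorm (z.1 - z0.1) <= q /\ `|z.2 - z0.2| <= q.
  by rewrite /C; split=> -[/= zq]; rewrite in_itv/= ler_distl.
have CU z : C z -> U z.
  by move=> /CP[zq sq]; apply: HU; [exact: le_lt_trans zq qU|exact: le_lt_trans sq qU].
have nC : nbhs z0 [set z | C z /\ phi z < e * eta / 2].
  have eta2 : 0 < e * eta / 2 by rewrite divr_gt0// mulr_gt0.
  have nphi : nbhs z0 [set z | phi z < e * eta / 2].
    have := cphi z0 _ (nbhsx_ballx _ _ eta2); rewrite nbhs_simpl/=; apply: filterS => z /=.
    by rewrite /ball/= phi0 sub0r normrN => /(le_lt_trans (ler_norm _)).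
  have nC0 : nbhs z0 C.
    by apply/nbhs_boxP; exists q => // z zq sq; apply/CP; split; exact: ltW.
  by apply: filterS2 nC0 nphi.
have eta20 : 0 < e * eta / 2 by rewrite divr_gt0// mulr_gt0.
have [w [z' [Fw [Cz' phiz'] wz']]] := Happ _ _ eta20 nC.
have uw : usc_on C w by move=> z b _; exact: uF.
have [z1 Cz1 z1max] := usc_compact_max cC Cz' (usc_onB uw (fun z _ => cphi z)).
have z1W : (w z1 <= W z1)%E by apply: FW => //; exact: CU.
have [zq sq] := (CP _).1 Cz1.
have := Hd z1 (le_lt_trans zq qd) (le_lt_trans sq qd); rewrite W0 => W1.
have [r wr ar] : exists2 r : R, w z1 = r%:E & a - e * eta < r - phi z1.
  have : ((a - e * eta)%:E < w z1 - (phi z1)%:E)%E.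
    apply: lt_le_trans (z1max _ Cz'); rewrite lteBrDr// -EFinD; apply: le_lt_trans wz'.
    by rewrite lee_fin; move: phiz'; clear; lra.
  move: (le_trans z1W W1); case: (w z1) => [r| |]// _.
  by rewrite -EFinB lte_fin => ?; exists r.
have := le_trans z1W W1; rewrite wr -EFinD lee_fin => rW.
set A := enorm (z1.1 - z0.1) in zq rW; set s := z1.2 - z0.2 in sq rW.
have A0 : 0 <= A by exact: enorm_ge0.
have key : A ^+ 2 + s ^+ 2 / eta < eta + `|s|.
  have : e * (A ^+ 2 + s ^+ 2 / eta) < e * (eta + `|s|).
    have -> : e * (A ^+ 2 + s ^+ 2 / eta) = e * A ^+ 2 + c * s ^+ 2.
      by rewrite /c; field; exact: lt0r_neq0.
    move: ar rW; rewrite phiE -/A -/s; clear; lra.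
  by rewrite ltr_pM2l.
have s2 : s ^+ 2 = `|s| ^+ 2 by rewrite real_normK ?num_real.
have sA : A ^+ 2 < 2 * eta /\ `|s| < 2 * eta.
  have s0 : 0 <= `|s| by [].
  move: key; rewrite s2; move: `|s| s0 => u u0 key.
  have key2 : A ^+ 2 * eta + u ^+ 2 < eta ^+ 2 + u * eta.
    have := ltr_pM2l eta0; rewrite -(ltr_pM2l eta0) in key.
    have E : eta * (A ^+ 2 + u ^+ 2 / eta) = A ^+ 2 * eta + u ^+ 2.
      by field; exact: lt0r_neq0.
    by move: key; rewrite E; clear; lra.
  have A2 : 0 <= A ^+ 2 by rewrite sqr_ge0.
  split.
    rewrite -(ltr_pM2r eta0); have : 0 <= (u - eta / 2) ^+ 2 by rewrite sqr_ge0.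
    have : 0 < eta ^+ 2 by rewrite exprn_gt0.
    by move: key2; clear; lra.
  rewrite ltNge; apply/negP => h; move: key2; rewrite ltNge => /negP; apply.
  have h1 := mulr_ge0 (ltW eta0) A2.
  have h2 : 0 <= (u - 2 * eta) * u by rewrite mulr_ge0// subr_ge0.
  have h3 : 0 <= (u - 2 * eta) * eta by rewrite mulr_ge0 ?subr_ge0// ltW.
  have h4 : 0 < eta ^+ 2 by rewrite exprn_gt0.
  by clear -h1 h2 h3 h4; lra.
have [A2 s1] := sA.
have Aq : A < q.
  by rewrite -(@ltr_pXn2r _ 2)// ?nnegrE ?(ltW q0)//; exact: lt_trans A2 eta_q.
have sq' : `|s| < q by apply: lt_trans s1 (lt_le_trans eta_q qq).
exists w, z1, (p + (z1.1 - z0.1) *m Y), e, (t + 2 * c * s); split=> //.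
- exact: CU.
- have := superjet_quad z0 0 p t c z1 sY; apply: superjet_shift.
  apply/nbhs_boxP; exists (Num.min (q - A) (q - `|s|)).
    by rewrite lt_min !subr_gt0 Aq.
  move=> z; rewrite !lt_min => /andP[zA _] /andP[_ zs].
  have Cz : C z.
    apply/CP; split.
      have -> : z.1 - z0.1 = (z.1 - z1.1) + (z1.1 - z0.1) by rewrite addrA subrK.
      apply: le_trans (ler_enormD _ _) _; move: zA; rewrite -/A; clear; lra.
    have -> : z.2 - z0.2 = (z.2 - z1.2) + s by rewrite /s addrA subrK.
    apply: le_trans (ler_normD _ _) _; move: zs; clear; lra.
  have := z1max _ Cz; rewrite wr -EFinB -/(phi _) -/(phi _).
  rewrite leeBlDr// -EFinD => /le_trans; apply; rewrite lee_fin; clear; lra.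
- split.
  + by rewrite ep/=; move: e8 e00; clear; lra.
  + rewrite -/A; apply: lt_le_trans Aq _; have : 0 <= q * K by rewrite mulr_ge0// ltW.
    by move: qK e00; clear; lra.
  + rewrite (addrAC p) subrr add0r; apply: le_lt_trans (HK _) _; rewrite -/A.
    have : K * A <= K * q by rewrite ler_wpM2l// ltW.
    by move: qK e00 q0; clear; lra.
  + have : - (4 * e) <= 2 * c * s.
      have : c * (2 * eta) = 2 * e by rewrite /c; field; exact: lt0r_neq0.
      have : c * `|s| <= c * (2 * eta) by rewrite ler_pM2l// ltW.
      have : c * - s <= c * `|s| by rewrite ler_pM2l// -normrN ler_norm.
      by clear; lra.
    by move: e8 ep; clear; lra.
Qed.


Lemma mxnorm_scalar_le k : `|k%:M : 'M[R]_n| <= `|k|.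
Proof.
rewrite [leLHS]/Num.norm/= mx_normrE; apply/bigmax_leP; split=> // -[i j] _ /=.
by rewrite mxE; case: eqP => _ /=; rewrite ?mulr1n ?mulr0n// normr0.
Qed.

Variables (f : V -> R) (c r0 : R).
Hypotheses (n_gt0 : (0 < n)%N) (c_ge0 : 0 <= c) (f_ge0 : forall x, 0 <= f x)
  (f_le : forall x, f x <= c) (f_supp : forall x, r0 < enorm x -> f x = 0).

Definition compact_subsolution (w : V * R -> R) : Prop :=
  is_subsolution f (fun=> 0) w /\ compactly_supported w.

Definition perron z : R := sup [set w z | w in compact_subsolution].

Lemma zero_compact_subsolution : compact_subsolution (fun=> 0).
Proof.
by split; [exact: zero_subsolution|move=> T _; exists 1].
Qed.

Lemma perron_has_sup z : 0 <= z.2 -> has_sup [set w z | w in compact_subsolution].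
Proof.
move=> z0; split; first by exists 0; exists (fun=> 0) => //; exact: zero_compact_subsolution.
exists (c * z.2) => _ [w [sw cw] <-].
exact: (subsolution_le_linear c_ge0 f_ge0 f_le sw cw).
Qed.

Lemma perron_ge w z : compact_subsolution w -> 0 <= z.2 -> w z <= perron z.
Proof. by move=> sw z0; apply: sup_upper_bound; [exact: perron_has_sup|exists w]. Qed.

Lemma perron_ge0 z : 0 <= z.2 -> 0 <= perron z.
Proof. exact: (perron_ge zero_compact_subsolution). Qed.

Lemma perron_le z a : 0 <= z.2 -> (forall w, compact_subsolution w -> w z <= a) ->
  perron z <= a.
Proof.
move=> z0 H; apply: ge_sup => [|_ [w sw <-]]; last exact: H.
by exists 0; exists (fun=> 0) => //; exact: zero_compact_subsolution.
Qed.

Lemma perron_le_linear z : 0 <= z.2 -> perron z <= c * z.2.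
Proof.
move=> z0; apply: perron_le => // w [sw cw].
exact: (subsolution_le_linear c_ge0 f_ge0 f_le sw cw).
Qed.

Lemma perron_compactly_supported : compactly_supported perron.
Proof.
move=> T T0; have [r rp Hr] := subsolution_support c_ge0 f_ge0 f_le f_supp T0.
exists r => // x t; rewrite /eball/= subr0 => /negP; rewrite -leNgt => rx /andP[t0 tT].
apply/eqP; rewrite eq_le perron_ge0// andbT; apply: perron_le => // w [sw cw].
by apply: (Hr w) => //=; rewrite t0.
Qed.

Lemma perron_locally_bounded : locally_bounded spacetime perron.
Proof.
apply/locally_boundedP => z z0; exists (c * (z.2 + 1)).
apply/nbhs_boxP; exists 1 => // y _ yz y0; rewrite ger0_norm ?perron_ge0//.
apply: le_trans (perron_le_linear y0) _; rewrite ler_wpM2l//.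
by move: yz; rewrite ltr_norml => /andP[_]; lra.
Qed.

(** The semicontinuity of [Hlow] and of the envelope of [f] passes the
    inequality from the approximating superjets to the limit. *)
Lemma perron_subsolution : is_subsolution f (fun=> 0) perron.
Proof.
split; first exact: perron_locally_bounded.
- move=> x; apply/lee_addgt0Pr => e e0; rewrite add0e; apply: usc_env_le.
  apply/nbhs_boxP; exists (e / (c + 1)) => [|y _]; first by rewrite divr_gt0// ltr_wpDl.
  rewrite subr0 => /(le_lt_trans (ler_norm _)); rewrite ltr_pdivlMr ?ltr_wpDl// => ye y0.
  rewrite lee_fin; apply: le_trans (perron_le_linear y0) _.
  have : 0 <= y.2 by exact: y0.
  by move: ye; lra.
- move=> z p X t z0 jS.
  have zS : spacetime z by exact: ltW.
  have [a aE] := usc_env_fin zS perron_locally_bounded.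
  rewrite leNgt; apply/negP => fH.
  have [b [bH bf]] : exists b : R, (b%:E < Hlow p X)%E /\ (usc_env setT f z.1 < (t + b)%:E)%E.
    have := source_env_ge0 f_ge0 z.1; have := source_env_le f_le z.1.
    case: (usc_env setT f z.1) fH => [y| |]// + _ _.
    case: (Hlow p X) => [h| |]//.
      by rewrite -EFinD lte_fin => yth; exists ((h + (y - t)) / 2); rewrite !lte_fin; lra.
    by move=> _; exists (y - t + 1); rewrite ltry lte_fin; split=> //; lra.
  have [g g0 fg] : exists2 g : R, 0 < g & (usc_env setT f z.1 < (t + b - g)%:E)%E.
    have := source_env_ge0 f_ge0 z.1; case: (usc_env setT f z.1) bf => [y| |]//.
    by rewrite lte_fin => yb _; exists ((t + b - y) / 2); rewrite ?lte_fin; lra.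
  have /nbhs_mxP[d d0 Hd] := lsc_env_near_gt bH.
  have /nbhs_eballP[d' d'0 Hd'] := usc_env_near_lt fg.
  pose F := [set usc_env spacetime w | w in compact_subsolution].
  have uF w : F w -> usc_on setT w by move=> [v _ <-] y A _; exact: usc_env_near_lt.
  have FS w y : F w -> [set y : V * R | 0 < y.2] y -> (w y <= usc_env spacetime perron y)%E.
    move=> [v sv <-] _; apply: usc_env_le_env; apply: near_all => y' y0; exact: perron_ge.
  have app e P : 0 < e -> nbhs z P ->
      exists w y, [/\ F w, P y & ((a - e)%:E < w y)%E].
    move=> e0 Pz; have : ((a - e)%:E < usc_env spacetime perron z)%E by rewrite aE lte_fin; lra.
    move=> /usc_env_gt_near/(_ Pz)[y [Py y0]]; rewrite lte_fin => ay.
    have ay0 : 0 < perron y - (a - e) by rewrite subr_gt0.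
    have [_ [w sw <-] wy] := sup_adherent ay0 (perron_has_sup y0).
    exists (usc_env spacetime w), y; split=> //; first by exists w.
    apply: lt_le_trans (usc_env_ge w y0); rewrite lte_fin; move: wy; rewrite -/(perron y); lra.
  pose e0 := Num.min (Num.min (d / 4) d') g.
  have e00 : 0 < e0 by rewrite !lt_min d'0 g0 divr_gt0.
  have [ed ed' eg] : [/\ e0 <= d / 4, e0 <= d' & e0 <= g].
    by rewrite /e0; split; rewrite !ge_min lexx ?orbT.
  have [w [z1 [p1 [e [t1 [[v [sv cv] <-] z10 jv [/andP[ep ee] zz pp tt]]]]]]] :=
    superjet_approx (near_positive z0) uF FS aE app jS e00.
  have [_ _ Hv] := sv.
  have := Hv _ _ _ _ z10 jv.
  have H1 : (b%:E < Hlow p1 (X + (4 * e)%:M))%E.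
    apply: Hd; first by apply: lt_le_trans pp _; apply: le_trans ed _; lra.
    rewrite addrAC subrr add0r; apply: le_lt_trans (mxnorm_scalar_le _) _.
    by rewrite gtr0_norm ?mulr_gt0//; lra.
  have H2 : (usc_env setT f z1.1 < (t + b - g)%:E)%E by apply: Hd'; exact: lt_le_trans zz ed'.
  rewrite leNgt => /negP; apply; apply: lt_le_trans H2 _.
  apply: le_trans (leeD2l _ (ltW H1)); rewrite -EFinD lee_fin; lra.
Qed.

(** Were the supremum not a supersolution at some point, a paraboloid glued on
    top of it there would be a larger subsolution with compact support. *)
Lemma perron_supersolution : is_supersolution f (fun=> 0) perron.
Proof.
split; first exact: perron_locally_bounded.
  by move=> x; apply: lsc_env_ge; apply: near_all => y y0; rewrite lee_fin perron_ge0.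
move=> z p X t z0 [sX' jS].
have sX : X^T = X by move: sX'; rewrite linearN/= => /oppr_inj.
have zS : spacetime z by exact: ltW.
have [a aE] := lsc_env_fin zS perron_locally_bounded.
rewrite leNgt; apply/negP => Hf.
have f0 : (0 <= lsc_env setT f z.1)%E by apply: lsc_env_ge; apply: near_all => y _; rewrite lee_fin.
have fc : (lsc_env setT f z.1 <= c%:E)%E.
  by apply: le_trans (lsc_env_le f I) _; rewrite lee_fin.
have [b [g [g0 Hb fb]]] : exists b g : R, [/\ 0 < g, (Hupp p X < b%:E)%E &
    ((t + b + g)%:E < lsc_env setT f z.1)%E].
  case: (lsc_env setT f z.1) f0 fc Hf => [y| |]// _ _; case: (Hupp p X) => [h| |]//.
    rewrite -EFinD lte_fin => hy; exists (h + (y - t - h) / 3), ((y - t - h) / 3).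
    by rewrite !lte_fin; split; lra.
  by move=> _; exists (y - t - 2), 1; rewrite ltNyr lte_fin; split=> //; lra.
have /nbhs_mxP[d d0 Hd] := usc_env_near_lt Hb.
have /nbhs_eballP[d' d'0 Hd'] := lsc_env_near_gt fb.
pose e := Num.min (g / 2) (d / 8).
have ep : 0 < e by rewrite lt_min !divr_gt0.
have e20 : 0 <= 2 * e by rewrite mulr_ge0// ltW.
have eg : e <= g / 2 by rewrite ge_min lexx.
have ed : e <= d / 8 by rewrite ge_min lexx orbT.
have /nbhs_boxP[d1 d10 Hd1] := jS e ep.
pose Y := X - (4 * e)%:M.
have sY : Y^T = Y by rewrite linearB/= tr_scalar_mx sX.
have [K K0 HK] := enorm_mulmx Y.
pose q := Num.min (Num.min 1 (d1 / 2)) (Num.min (Num.min (d' / 2) (z.2 / 2)) (d / 2 / (K + 1))).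
have q0 : 0 < q by rewrite !lt_min ltr01 !divr_gt0// ltr_wpDl.
have q1 : q <= 1 by rewrite !ge_min lexx.
have qd1 : q <= d1 / 2 by rewrite !ge_min lexx !orbT.
have qd' : q <= d' / 2 by rewrite !ge_min lexx !orbT.
have qz : q <= z.2 / 2 by rewrite !ge_min lexx !orbT.
have qK : q * (K + 1) <= d / 2 by rewrite -ler_pdivlMr ?ltr_wpDl// !ge_min lexx !orbT.
pose r (y : V * R) : R := `|y.2 - z.2| + enorm (y.1 - z.1) ^+ 2.
have cr : continuous (r : V * R -> R).
  move=> y; apply: cvgD.
    apply: (@continuous_comp _ _ _ (fun y : V * R => y.2 - z.2) (fun s : R => `|s|)).
      exact: shift_snd_continuous.
    exact: norm_continuous.
  apply: (@continuous_comp _ _ _ (fun y : V * R => enorm (y.1 - z.1)) (fun s : R => s ^+ 2)); last exact: exprn_continuous.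
  by apply: (@continuous_comp _ _ _ fst (fun x : V => enorm (x - z.1) : R)); [exact: cvg_fst|exact: enormB_continuous].
(* the bump is [k] above the envelope at [z] and below it where [q ^+ 2 <= r] *)
pose k := e * q ^+ 2.
have k0 : 0 < k by rewrite mulr_gt0// exprn_gt0.
pose phi := quad z (a + k) p Y t (2 * e).
have phiE y : phi y = a + k + quad z 0 p X t 0 y - 2 * e * r y.
  rewrite /phi quad0E /quad /Y qformDl qformNl qform_scalar /r; lra.
pose D : set (V * R) := [set y | r y < q ^+ 2].
pose C : set (V * R) := [set y | r y <= q ^+ 2].
have Cq y : C y -> enorm (y.1 - z.1) <= q /\ `|y.2 - z.2| <= q.
  rewrite /C/= /r => ry; split.
    rewrite -(@ler_pXn2r _ 2)// ?nnegrE ?enorm_ge0 ?(ltW q0)//.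
    by apply: le_trans ry; rewrite lerDr.
  apply: (@le_trans _ _ (q ^+ 2)); last by rewrite expr2 ger_pMr.
  by apply: le_trans ry; rewrite lerDl sqr_ge0.
have C0 y : C y -> 0 < y.2.
  by move=> /Cq[_]; rewrite ler_norml => /andP[+ _]; move: qz z0; lra.
have Slow y : C y -> a + quad z 0 p X t 0 y - e * r y <= perron y.
  move=> Cy; have [yq sq] := Cq _ Cy.
  have y1 : enorm (y.1 - z.1) < d1 by apply: le_lt_trans yq _; lra.
  have s1 : `|y.2 - z.2| < d1 by apply: le_lt_trans sq _; lra.
  have /= := Hd1 y y1 s1.
  rewrite -/(qform _ _) qformNl dotvNl aE -EFinN -EFinD leeNl -EFinN.
  move=> /le_trans/(_ (lsc_env_le perron (ltW (C0 _ Cy)))); rewrite lee_fin quad0E /r; lra.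
have sub : is_subsolution f (fun=> 0) (gluemax C perron phi).
  apply: (@gluemax_subsolution _ _ _ _ _ _ C D perron_subsolution).
  - exact: quad_continuous.
  - have -> : C = r @^-1` [set s | s <= q ^+ 2] by [].
    by apply: preimage_closed; [move=> y _; exact: cr|exact: closed_le].
  - have -> : D = r @^-1` [set s | s < q ^+ 2] by [].
    by apply: open_comp; [move=> y _; exact: cr|exact: open_lt].
  - by move=> y; rewrite /D /C /=; exact: ltW.
  - move=> y Cy _ Sphi; rewrite /D/=; have := Slow _ Cy; move: Sphi; rewrite phiE /k => h1 h2.
    rewrite -(ltr_pM2l ep); lra.
  - by move=> y /ltW; exact: C0.
  - move=> y p' X' t' /ltW Dy _ jphi; have [yq sq] := Cq _ Dy.
    have [p'E YX' tt'] := superjet_quad_inv sY e20 jphi.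
    have sX'' := superjet_sym jphi.
    have H1 : (Hlow p' X' <= b%:E)%E.
      apply: le_trans (Hlow_mono _ sY sX'' YX') _.
      apply: le_trans (Hlow_le_Hupp n_gt0 _ sY) _; apply: ltW; apply: Hd.
        rewrite p'E (addrAC p) subrr add0r; apply: le_lt_trans (HK _) _.
        have : K * enorm (y.1 - z.1) <= K * q by rewrite ler_wpM2l.
        by move: qK q0 d0; lra.
      rewrite /Y addrAC subrr add0r normrN; apply: le_lt_trans (mxnorm_scalar_le _) _.
      by rewrite gtr0_norm ?mulr_gt0//; lra.
    apply: le_trans (leeD2l _ H1) _.
    have fy : ((t + b + g)%:E < lsc_env setT f y.1)%E.
      by apply: Hd'; apply: le_lt_trans yq _; lra.
    apply: le_trans (usc_env_ge f I); apply: le_trans (lsc_env_le f I).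
    by apply: le_trans (ltW fy); rewrite -EFinD lee_fin; lra.
have csub : compactly_supported (gluemax C perron phi).
  apply: (@gluemax_support _ _ _ _ _ (enorm z.1 + q + 1)).
  - by rewrite ltr_wpDl// addr_ge0 ?enorm_ge0// ltW.
  - exact: perron_compactly_supported.
  - move=> y /Cq[yq _]; have := ler_enormB y.1 z.1 => /(le_trans (ler_norm _)).
    by move: yq; lra.
have phiS y : C y -> phi y <= perron y.
  move=> Cy; apply: le_trans (gluemax_ger perron phi Cy) _.
  by apply: perron_ge; [split|exact: ltW (C0 _ Cy)].
have phiz : phi z = a + k.
  by rewrite /phi /quad !subrr dotv0 qform0 normr0; ring.
have : ((a + k / 2)%:E <= lsc_env spacetime perron z)%E.
  have k20 : 0 < k / 2 by rewrite divr_gt0.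
  have := @quad_continuous R n z (a + k) p Y t (2 * e) z _ (nbhsx_ballx _ _ k20).
  rewrite nbhs_simpl/= => H1.
  have H2 : nbhs z C.
    apply: (@filterS _ _ _ D); first by move=> y; rewrite /D /C/=; exact: ltW.
    apply: open_nbhs_nbhs; split.
      have -> : D = r @^-1` [set s | s < q ^+ 2] by [].
      by apply: open_comp; [move=> y _; exact: cr|exact: open_lt].
    by rewrite /D/= /r !subrr normr0 enorm0 expr0n/= addr0 exprn_gt0.
  apply: lsc_env_ge; apply: filterS2 H1 H2 => y /=; rewrite -/(phi _) -/(phi _) phiz /ball/=.
  rewrite ltr_distlC => /andP[h _] /phiS h' _; rewrite lee_fin; lra.
by rewrite aE lee_fin; lra.
Qed.

(** Maximality does the work of a comparison principle: the Perron function is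
    itself a compactly supported solution, hence a competitor. *)
Lemma maximal_solution_ge u w : is_maximal_solution f (fun=> 0) u ->
  compact_subsolution w -> forall z, 0 <= z.2 -> w z <= u z.
Proof.
move=> [_ _ umax] sw [x t] /= t0; apply: le_trans (@perron_ge w (x, t) sw t0) _.
apply: umax => //; last exact: perron_compactly_supported.
by split; [exact: perron_subsolution|exact: perron_supersolution].
Qed.

End Perron.

(** * The obstacle problem *)
Section ObstacleLemmas.
Context {R : realType} {n : nat}.
Local Notation V := 'rV[R]_n.
Implicit Types (p h x y : V) (X Y : 'M[R]_n) (z : V * R) (t k e a : R) (E : set V).

Lemma edistance_ge0 x E : (0 <= edistance x E)%E.
Proof. by apply: le_ereal_inf_tmp => _ [y _ <-]; rewrite lee_fin enorm_ge0. Qed.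

Lemma edistance_le x y E : E y -> (edistance x E <= (enorm (x - y))%:E)%E.
Proof. by move=> Ey; apply: ereal_inf_lbound; exists y. Qed.

Lemma obstacleE x E : (obstacle E x)%:E =
  Order.max (-1)%:E (Order.min 1%:E (edistance x (~` E) - edistance x E))%E.
Proof.
rewrite /obstacle fineK// fin_numElt; apply/andP; split.
  by rewrite lt_max ltNyr.
by rewrite gt_max ltry/= gt_min ltry.
Qed.

Lemma obstacle_le x E a : -1 <= a ->
  (edistance x (~` E) - edistance x E <= a%:E)%E -> obstacle E x <= a.
Proof. by move=> a1 H; rewrite -lee_fin obstacleE ge_max lee_fin a1/= ge_min H orbT. Qed.

Lemma obstacle_out x E : ~ E x -> (edistance x (~` E) = 0)%E.
Proof.
move=> nE; apply/eqP; rewrite eq_le edistance_ge0 andbT.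
by have := @edistance_le x x (~` E) nE; rewrite subrr enorm0.
Qed.

Lemma obstacle_out_le0 x E : ~ E x -> obstacle E x <= 0.
Proof.
move=> nE; apply: obstacle_le; first by rewrite oppr_le0.
by rewrite obstacle_out// add0e oppe_le0 edistance_ge0.
Qed.

Lemma obstacle_far x E : (forall y, E y -> 1 <= enorm (x - y)) -> ~ E x ->
  obstacle E x <= -1.
Proof.
move=> H nE; apply: obstacle_le => //; rewrite obstacle_out// add0e EFinN leeN2.
by apply: le_ereal_inf_tmp => _ [y Ey <-]; rewrite lee_fin; exact: H.
Qed.

Lemma obstacle_ball x E a : 0 <= a -> a < obstacle E x -> eball x a `<=` E.
Proof.
move=> a0 ax y; rewrite /eball/= => yx; apply: contrapT => nEy.
move: ax; rewrite ltNge => /negP; apply; apply: obstacle_le.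
  by apply: le_trans a0; rewrite oppr_le0.
apply: (@le_trans _ _ (edistance x (~` E))); first by rewrite -[leRHS]adde0 leeD2l// oppe_le0 edistance_ge0.
by apply: le_trans (edistance_le _ nEy) _; rewrite enormBC lee_fin ltW.
Qed.

Lemma bounded_enorm E : compact E -> exists2 r : R, 0 <= r & forall y, E y -> enorm y <= r.
Proof.
move=> /compact_bounded[M [_ /(_ (`|M| + 1))]].
rewrite (le_lt_trans (ler_norm M)) ?ltrDl// => /(_ isT) H.
exists (n.+1%:R * (`|M| + 1)); first by rewrite mulr_ge0// addr_ge0.
by move=> y /H yM; apply: le_trans (enorm_le_mx_norm _) _; rewrite ler_wpM2l.
Qed.

Variables (E : set V) (v : V * R -> R).
Hypotheses (cE : compact E) (vE : is_obstacle_solution E v).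

(** Continuous on the whole space, unlike [v], whose values at negative times
    are arbitrary. *)
Definition extension (z : V * R) : R := v (z.1, Num.max 0 z.2).

Lemma extension_id z : 0 <= z.2 -> extension z = v z.
Proof. by case: z => x t /= t0; rewrite /extension/= max_r. Qed.

Lemma extension_neg z : z.2 <= 0 -> extension z = obstacle E z.1.
Proof. by case: vE => _ _ v0 _ _ t0; rewrite /extension max_l// v0. Qed.

Lemma extension_continuous : continuous extension.
Proof.
case: vE => _ /subspace_continuousP cv _ _ _ z N.
pose q (z : V * R) : V * R := (z.1, Num.max 0 z.2).
have qS (y : V * R) : spacetime (q y) by rewrite /spacetime/= le_max lexx.
move=> /(cv (q z) (qS z)); rewrite !nbhs_simpl/= /within/= => H.
have cq : {for z, continuous q}.
  move=> P; rewrite !nbhs_simpl/= => /nbhs_boxP[e e0 He]; apply/nbhs_boxP; exists e => // y y1 y2.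
  apply: He => //=; apply: le_lt_trans y2.
  have m0 (s s' : R) : Num.max 0 s - Num.max 0 s' <= `|s - s'|.
    rewrite lerBlDr ge_max addr_ge0 ?le_max ?lexx//=.
    rewrite -lerBlDr; apply: le_trans (ler_norm _).
    by rewrite lerD2l lerN2 le_max lexx orbT.
  by rewrite ler_norml m0 andbT lerNl opprB distrC m0.
by have := cq _ H; rewrite nbhs_simpl/=; apply: filterS => y; apply; exact: qS.
Qed.

Lemma extension_superjet z p X t : 0 < z.2 -> obstacle E z.1 < extension z ->
  superjet (EFin \o extension) z p X t -> (t%:E + Hlow p X <= 0)%E.
Proof.
case: vE => _ _ _ vsub _ z0 vz jv.
have jv' : superjet (EFin \o v) z p X t.
  apply: superjet_le jv; last by rewrite /= extension_id// ltW.
  by apply: filterS (near_positive z0) => y /= y0; rewrite extension_id// ltW.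
have := vsub z p X t z0 jv'; rewrite ge_min => /orP[//|].
by rewrite lee_fin subr_le0 leNgt -extension_id ?vz// ltW.
Qed.

Lemma extension_bounded : exists2 M : R, 0 <= M & forall z, `|extension z| <= M.
Proof.
case: vE => [[M [_ /(_ (`|M| + 1))]]].
rewrite (le_lt_trans (ler_norm M)) ?ltrDl// => /(_ isT) H _ _ _ _.
exists (`|M| + 1) => [|z]; first by rewrite addr_ge0.
by apply: H; rewrite /spacetime/= le_max lexx.
Qed.

(** Far from the obstacle, the solution starts from -1 and stays below a steep
    paraboloid which rises slowly in time. *)
Lemma extension_support T : 0 < T -> exists2 r : R, 0 < r &
  forall z, r <= enorm z.1 -> 0 <= z.2 <= T -> extension z <= 0.
Proof.
move=> T0; have [r0 r00 Er] := bounded_enorm cE.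
have [M M0 vM] := extension_bounded.
(* a radius for which the paraboloid through the bound [M] at distance [q]
   rises by at most 1 before time [T] *)
pose N := (M + 1) * (2 * n%:R + 3) * T; pose q := N + 1.
have N0 : 0 <= N by rewrite !mulr_ge0 ?addr_ge0 ?mulr_ge0// ltW.
have q1 : 1 <= q by rewrite lerDr.
have q0 : 0 < q by exact: lt_le_trans q1.
pose A := (M + 1) / q ^+ 2; pose L := 2 * n%:R + 2 * q + 1.
have q20 : 0 < q ^+ 2 by rewrite exprn_gt0.
have A0 : 0 < A by rewrite divr_gt0// ltr_wpDl.
have L0 : 0 < L by rewrite ltr_wpDl// addr_ge0// mulr_ge0// ltW.
exists (r0 + q + 2) => [|z0 rz0 /andP[z00 z0T]]; first by rewrite ltr_wpDl// addr_ge0// ltW.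
pose x0 := z0.1.
have far x : enorm (x - x0) <= q -> obstacle E x <= -1.
  move=> xx0; have xr : r0 + 2 <= enorm x.
    have := ler_enormB x0 x => /(le_trans (ler_norm _)); rewrite enormBC; move: rz0 xx0.
    by rewrite -/x0; clear -cE vE; lra.
  apply: obstacle_far => [y Ey|Ex]; last by have := Er _ Ex; move: xr; clear -cE vE; lra.
  have := ler_enormB x y => /(le_trans (ler_norm _)); have := Er _ Ey; move: xr; clear -cE vE; lra.
pose b z : R := -1 + (A * L) * z.2 + A * enorm (z.1 - x0) ^+ 2.
have bge z : 0 <= z.2 -> -1 <= b z.
  move=> z20; have h1 : 0 <= A * L * z.2 by rewrite mulr_ge0// mulr_ge0// ltW.
  have h2 : 0 <= A * enorm (z.1 - x0) ^+ 2 by rewrite mulr_ge0 ?sqr_ge0// ltW.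
  by rewrite /b; move: h1 h2; clear -cE vE; lra.
suff H : extension z0 <= b z0.
  apply: le_trans H _; rewrite /b subrr enorm0 expr0n/= mulr0 addr0 -lerBrDl sub0r opprK.
  have AL0 : 0 <= A * L by rewrite mulr_ge0// ltW.
  have : A * L * z0.2 <= A * L * T by rewrite ler_wpM2l.
  move=> /le_trans; apply.
  have -> : A * L * T = (M + 1) * T * L / q ^+ 2.
    by rewrite /A -!mulrA; congr (_ * _); rewrite mulrC -!mulrA mulrCA.
  rewrite ler_pdivrMr// mul1r.
  have : (M + 1) * T * L <= (M + 1) * T * ((2 * n%:R + 3) * q).
    rewrite ler_wpM2l//; first by rewrite mulr_ge0 ?addr_ge0// ltW.
    rewrite /L.
    have : n%:R <= n%:R * q by rewrite ler_peMr.
    by move: q1; clear -cE vE; lra.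
  have : N * q <= q ^+ 2 by rewrite expr2 ler_wpM2r ?(ltW q0)// /q lerDl.
  by rewrite /N; clear -cE vE; lra.
rewrite leNgt; apply/negP => bz0.
pose S := T + 1.
pose C : set (V * R) := [set y | enorm (y - x0) <= q] `*` `[0, S]%classic.
have CP z : C z -> enorm (z.1 - x0) <= q /\ 0 <= z.2 <= S.
  by case=> /= ? ; rewrite in_itv.
have cC : compact C by exact: compact_box.
have uv : usc_on C (EFin \o extension).
  move=> z a Cz; case: a => [a| |]; last by rewrite ltNge leNye.
    rewrite lte_fin => va; have : nbhs (extension z) [set s | s < a].
      by apply: open_nbhs_nbhs; split => //; exact: open_lt.
    by move=> /extension_continuous; rewrite nbhs_simpl/=; apply: filterS.
  by move=> _; apply: near_all => y; rewrite ltry.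
have Cz0 : C z0 by split; rewrite /= ?subrr ?enorm0 ?(ltW q0)// in_itv/= z00 /S; lra.
have z0S : z0.2 < S by rewrite /S; lra.
have CS z : C z -> 0 <= z.2 <= S by case/CP.
have CM z : C z -> ((EFin \o extension) z <= (b z + (M + 1))%:E)%E.
  move=> /CP[_ /andP[z20 _]]; rewrite lee_fin; have := bge _ z20; have := vM z.
  by move=> /(le_trans (ler_norm _)); clear -cE vE; lra.
have cb : continuous b by exact: continuous_paraboloid.
have Cin z : C z -> z.2 < S -> ((b z)%:E < (EFin \o extension) z)%E -> nbhs z C.
  move=> Cz zS; rewrite lte_fin => bz; have [zq /andP[z20 _]] := CP _ Cz.
  have zp : 0 < z.2.
    rewrite lt_neqAle z20 andbT; apply/negP => /eqP z2.
    have := far _ zq; have := bge _ z20; have zn : z.2 <= 0 by rewrite -z2.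
    by move: bz; rewrite (extension_neg zn); lra.
  have zq' : enorm (z.1 - x0) < q.
    rewrite lt_neqAle zq andbT; apply/negP => /eqP zE.
    have := vM z => /(le_trans (ler_norm _)); rewrite leNgt => /negP; apply.
    apply: le_lt_trans bz; rewrite /b zE /A divfK ?gt_eqF//.
    have : 0 <= A * L * z.2 by rewrite mulr_ge0// mulr_ge0// ltW.
    by rewrite /A; clear -cE vE; lra.
  apply/nbhs_boxP; exists (Num.min (q - enorm (z.1 - x0)) (Num.min z.2 (S - z.2))).
    by rewrite !lt_min !subr_gt0 zq' zp.
  move=> y; rewrite !lt_min => /andP[y1 _] /andP[_ /andP[y2 y3]]; split => /=.
    have -> : y.1 - x0 = (y.1 - z.1) + (z.1 - x0) by rewrite addrA subrK.
    by apply: le_trans (ler_enormD _ _) _; move: y1; clear -cE vE; lra.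
  move: y2 y3; rewrite in_itv/= !ltr_norml => /andP[? _] /andP[_ ?]; apply/andP; split; lra.
have [z1 [k [k0 Cz1 bz1 nC jets]]] := touching cC uv cb CS CM Cz0 z0S bz0 Cin.
have [zq /andP[z10 _]] := CP _ Cz1.
have z1p : 0 < z1.2.
  move/nbhs_boxP: nC => [e e0 /(_ (z1.1, z1.2 - e / 2))] /=.
  have -> : z1.2 - e / 2 - z1.2 = - (e / 2) by ring.
  have e2 : e / 2 < e by lra.
  rewrite subrr enorm0 normrN gtr0_norm ?divr_gt0// => /(_ e0 e2) /CP[_ /= /andP[+ _]].
  by move: e0; clear -cE vE; lra.
move: bz1; rewrite lte_fin => bz1.
have ov : obstacle E z1.1 < extension z1.
  by apply: le_lt_trans (far _ zq) _; apply: le_lt_trans (bge _ z10) bz1.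
have := extension_superjet z1p ov (jets _ _ _ (superjet_paraboloid x0 (-1) A (A * L) z1)).
apply/negP; rewrite -ltNge; apply: lt_le_trans (leeD2l _ (Hlow_scalar_ge _ _)).
have A20 : 0 < 2 * A by rewrite pmulr_rgt0.
rewrite -EFinD lte_fin enormZ gtr0_norm//.
have := ler_wpM2l (ltW A0) zq.
by rewrite /L; move: k0 A0; clear -cE vE; lra.
Qed.

End ObstacleLemmas.

(** * Growth of the maximal solution *)
Section Moebius.
Context {R : realType}.
Implicit Types (a d l : R).

(** An increasing relabelling of the levels of the obstacle solution. Levels up
    to [0] fall below [0], level [d] becomes [l], level [2 * d] exceeds [l] by a
    third of [a], and no level exceeds [l + a]. The gain does not depend on [l]:
    the pole moves towards [0] as [l] grows, so that the steep part of the graph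
    absorbs the height of the previous steps. A homography has an explicit
    inverse, whose second order expansion is algebraic. *)
Definition moebius_pole a d l : R := a * d / (l + a).
Definition moebius a d l (m : R) : R :=
  l + a - a * (moebius_pole a d l + d) / (moebius_pole a d l + m).

Variables (a d l : R).
Hypotheses (a_gt0 : 0 < a) (d_gt0 : 0 < d) (l_ge0 : 0 <= l).
Local Notation pole := (moebius_pole a d l).
Local Notation theta := (moebius a d l).

Lemma moebius_pole_gt0 : 0 < pole.
Proof. by rewrite divr_gt0 ?mulr_gt0// ltr_wpDl. Qed.

Lemma moebius_gt0 : 0 < a * (pole + d).
Proof. by rewrite mulr_gt0// addr_gt0// moebius_pole_gt0. Qed.

Lemma moebius_mono m m' : 0 <= m -> m <= m' -> theta m <= theta m'.
Proof.
move=> m0 mm'; have p0 := moebius_pole_gt0.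
rewrite lerD2l lerN2 ler_wpM2l ?(ltW moebius_gt0)// lef_pV2 ?posrE ?lerD2l//.
  by rewrite ltr_wpDr// (le_trans m0).
by rewrite ltr_wpDr.
Qed.

Lemma moebius0 : theta 0 <= 0.
Proof.
have la : 0 < l + a by rewrite ltr_wpDl.
rewrite subr_le0 addr0 ler_pdivlMr ?moebius_pole_gt0// /moebius_pole.
rewrite mulrC divfK ?gt_eqF// mulrDr lerDr mulr_ge0// ?(ltW a_gt0)//.
exact: ltW moebius_pole_gt0.
Qed.

Lemma moebius_gap : theta d = l.
Proof. by rewrite /moebius mulfK ?addrK// gt_eqF// addr_gt0// moebius_pole_gt0. Qed.

Lemma moebius_2gap : l + a / 3 <= theta (2 * d).
Proof.
have p0 := moebius_pole_gt0; have la : 0 < l + a by rewrite ltr_wpDl.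
have pd : pole <= d.
  by rewrite /moebius_pole ler_pdivrMr// mulrC ler_pM2l// lerDr.
have pd2 : 0 < pole + 2 * d by rewrite addr_gt0// mulr_gt0.
rewrite /moebius -addrA lerD2l lerBrDr -lerBrDl ler_pdivrMr//.
by have := ler_wpM2l (ltW a_gt0) pd; lra.
Qed.

Lemma moebius_lt m : 0 <= m -> theta m < l + a.
Proof.
move=> m0; have pm : 0 < pole + m by rewrite ltr_wpDr// moebius_pole_gt0.
by rewrite /moebius ltrBlDr ltrDl divr_gt0// moebius_gt0.
Qed.

Lemma moebius_inv m : 0 <= m ->
  a * (pole + d) / (l + a - theta m) = pole + m.
Proof.
move=> m0; rewrite /moebius subKr.
have h : pole + m != 0 by rewrite gt_eqF// ltr_wpDr// moebius_pole_gt0.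
by rewrite invfM invrK mulrA divff ?mul1r// gt_eqF// moebius_gt0.
Qed.

End Moebius.

Lemma inverse_taylor_le {R : realType} (B b q : R) : 0 < B -> 0 < b -> `|q| <= b / 2 ->
  B / (b - q) - B / b <=
    B / b ^+ 2 * q + 2^-1 * (2 * B / b ^+ 3) * q ^+ 2 + 2 * B / b ^+ 4 * `|q| ^+ 3.
Proof.
move=> B0 b0 qb.
have qb' : q <= b / 2 by apply: le_trans qb; exact: ler_norm.
have bq : 0 < b - q by lra.
have -> : B / (b - q) - B / b = B / b ^+ 2 * q + 2^-1 * (2 * B / b ^+ 3) * q ^+ 2
    + B / b ^+ 3 * (q ^+ 3 / (b - q)).
  by field; rewrite !gt_eqF.
rewrite lerD2l.
have -> : 2 * B / b ^+ 4 * `|q| ^+ 3 = B / b ^+ 3 * (2 * `|q| ^+ 3 / b).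
  by field; rewrite gt_eqF.
rewrite ler_pM2l ?divr_gt0 ?exprn_gt0// ler_pdivrMr// mulrAC ler_pdivlMr//.
have q3 : q ^+ 3 <= `|q| ^+ 3 by rewrite -normrX ler_norm.
have : q ^+ 3 * b <= `|q| ^+ 3 * b by rewrite ler_pM2r.
have : 0 <= `|q| ^+ 3 * (b / 2 - q) by rewrite mulr_ge0 ?exprn_ge0// subr_ge0.
lra.
Qed.

Lemma superjet_translate_time {R : realType} {n : nat} (g : 'rV[R]_n * R -> R) s z p X t :
  superjet (EFin \o (fun z => g (z.1, z.2 - s))) z p X t ->
  superjet (EFin \o g) (z.1, z.2 - s) p X t.
Proof.
move=> /superjetP[sX H]; apply/superjetP; split=> // e /H[d d0 Hd]; exists d => // y y1 y2.
have := Hd (y.1, y.2 + s); rewrite !quad0E /= addrK opprB addrA -surjective_pairing addrAC.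
by move: y1 y2; rewrite /= opprB addrA addrAC => y1 y2 /(_ y1 y2).
Qed.

Section Growth.
Context {R : realType} {n : nat}.
Local Notation V := 'rV[R]_n.
Implicit Types (p h x y : V) (X Y : 'M[R]_n) (z : V * R) (t k e a d l s : R).
Variables (n_gt0 : (0 < n)%N) (c : R) (E : set V) (u v : V * R -> R).
Hypotheses (c_gt0 : 0 < c) (cE : compact E)
  (u_max : is_maximal_solution (fun x => c * \1_E x) (fun=> 0) u)
  (vE : is_obstacle_solution E v).
Local Notation f := (fun x => c * \1_E x).

Lemma source_ge0 x : 0 <= f x.
Proof. by rewrite mulr_ge0// ltW. Qed.

Lemma source_le x : f x <= c.
Proof. by rewrite ler_piMr ?(ltW c_gt0)// indicE; case: (_ \in _). Qed.

Lemma source_in x : E x -> f x = c.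
Proof. by move=> Ex; rewrite /= indicE mem_set// mulr1. Qed.

Lemma source_usc_ge x : E x -> (c%:E <= usc_env setT f x)%E.
Proof. by move=> /source_in {1}<-; exact: (usc_env_ge f). Qed.

Lemma maximal_ge w : is_subsolution f (fun=> 0) w -> compactly_supported w ->
  forall z, 0 <= z.2 -> w z <= u z.
Proof.
move=> sw cw; have [r _ Er] := bounded_enorm cE.
apply: (@maximal_solution_ge R n f c r n_gt0 (ltW c_gt0) source_ge0 source_le _ u w u_max).
  by move=> x rx; rewrite indicE memNset ?mulr0// => /Er; rewrite leNgt rx.
by split.
Qed.

Lemma maximal_sub : is_subsolution f (fun=> 0) u.
Proof. by case: u_max => -[]. Qed.

Lemma maximal_supp : compactly_supported u.
Proof. by case: u_max. Qed.

Lemma maximal_ge0 z : 0 <= z.2 -> 0 <= u z.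
Proof.
apply: (@maximal_ge (fun=> 0)); last by move=> T _; exists 1.
exact: (zero_subsolution n_gt0 (f := f) source_ge0).
Qed.

(** Birth: where a ball of radius [d] fits in [E], a paraboloid of curvature of
    order [a / d ^+ 2] can be glued on a plateau, and the smallness of [a] lets
    the source pay for its curvature and its rise in unit time. *)
Lemma birth d a l s : 0 < d -> 0 < a -> a * (1 + 8 * n%:R / d ^+ 2) <= c -> 0 <= s ->
  (forall x t, E x -> s <= t -> l <= u (x, t)) ->
  forall y t, eball y d `<=` E -> s + 1 <= t -> l + a <= u (y, t).
Proof.
move=> d0 a0 ac s0 lu y t yE st.
(* the bump has radius d / 2, so that its closed support stays in the ball *)
pose K := 8 * a / d ^+ 2.
have d20 : 0 < d ^+ 2 by rewrite exprn_gt0.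
have K0 : 0 < K by rewrite divr_gt0// mulr_gt0.
have sK : (- K)%:M^T = (- K)%:M :> 'M[R]_n by rewrite tr_scalar_mx.
pose phi := quad (y, t) (l + a) 0 (- K)%:M 0 a.
have cphi : continuous phi by exact: quad_continuous.
have phiE z : phi z = l + a - 2^-1 * K * enorm (z.1 - y) ^+ 2 - a * `|z.2 - t|.
  by rewrite /phi /quad dot0v qform_scalar /=; lra.
pose C : set (V * R) := [set z | l <= phi z]; pose D : set (V * R) := [set z | l < phi z].
have Cin z : C z -> [/\ E z.1, enorm (z.1 - y) < d & `|z.2 - t| <= 1].
  rewrite /C/= phiE => lphi.
  have h1 : 0 <= 2^-1 * K * enorm (z.1 - y) ^+ 2 by rewrite mulr_ge0 ?sqr_ge0// mulr_ge0// ltW.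
  have h2 : 0 <= a * `|z.2 - t| by rewrite mulr_ge0// ltW.
  have yd : enorm (z.1 - y) < d.
    rewrite -(@ltr_pXn2r _ 2)// ?nnegrE ?enorm_ge0 ?(ltW d0)//.
    have h3 : 4 * a * enorm (z.1 - y) ^+ 2 <= a * d ^+ 2.
      have : 2^-1 * K * enorm (z.1 - y) ^+ 2 * d ^+ 2 <= a * d ^+ 2 by rewrite ler_pM2r//; lra.
      apply: le_trans; rewrite /K le_eqVlt; apply/orP; left; apply/eqP; field.
      by rewrite gt_eqF.
    rewrite -(ltr_pM2l a0); have : 0 < a * d ^+ 2 by rewrite mulr_gt0.
    by move: h3; lra.
  split=> //; first exact: yE.
  by rewrite -(ler_pM2l a0); lra.
have Ct z : C z -> s <= z.2.
  by move=> /Cin[_ _]; rewrite ler_norml => /andP[+ _]; lra.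
have W : is_subsolution f (fun=> 0) (gluemax C u phi).
  apply: (@gluemax_subsolution _ _ _ _ _ _ C D maximal_sub) => //.
  - have -> : C = phi @^-1` [set r | l <= r] by [].
    by apply: preimage_closed; [move=> z _; exact: cphi|exact: closed_ge].
  - have -> : D = phi @^-1` [set r | l < r] by [].
    by apply: open_comp; [move=> z _; exact: cphi|exact: open_gt].
  - by move=> z; exact: ltW.
  - move=> z Cz _; apply: le_lt_trans; have := lu z.1 z.2; rewrite -surjective_pairing; apply.
      by case: (Cin _ Cz).
    exact: Ct.
  - move=> z lphi; have : `|z.2 - t| < 1.
      rewrite -(ltr_pM2l a0); move: lphi; rewrite /D/= phiE.
      have : 0 <= 2^-1 * K * enorm (z.1 - y) ^+ 2 by rewrite mulr_ge0 ?sqr_ge0// mulr_ge0// ltW.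
      lra.
    by rewrite ltr_norml => /andP[+ _]; lra.
  - move=> z p X t' lphi _ jphi; have [Ez _ _] := Cin _ (ltW lphi).
    have [_ YX tt'] := superjet_quad_inv sK (ltW a0) jphi.
    apply: le_trans (source_usc_ge Ez).
    have H : (Hlow p X <= (K * (n%:R - 1))%:E)%E.
      apply: le_trans (Hlow_mono _ sK (superjet_sym jphi) YX) _.
      by have := Hlow_scalar_le n_gt0 p (- K); rewrite mulNr opprK.
    apply: le_trans (leeD2l _ H) _; rewrite -EFinD lee_fin; apply: le_trans ac.
    have -> : a * (1 + 8 * n%:R / d ^+ 2) = a + K * n%:R by rewrite /K; field; rewrite gt_eqF.
    by move: K0 tt'; lra.
have cW : compactly_supported (gluemax C u phi).
  apply: (@gluemax_support _ _ _ _ _ (enorm y + d)); rewrite ?ltr_wpDl ?enorm_ge0//.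
    exact: maximal_supp.
  move=> z /Cin[_ zd _]; have := ler_enormB z.1 y => /(le_trans (ler_norm _)).
  by move: zd; lra.
have t0 : 0 <= t by lra.
have phiy : phi (y, t) = l + a by rewrite phiE/= !subrr enorm0 normr0 expr0n/= !mulr0 !subr0.
have Cy : C (y, t) by rewrite /C/= phiy lerDl ltW.
have := @maximal_ge _ W cW (y, t) t0; apply: le_trans.
by have := gluemax_ger u phi Cy; rewrite phiy.
Qed.

Local Notation vt := (extension v).

(** Spreading: glue the relabelled obstacle solution, started at time [s], on
    [u]. Where it touches the obstacle it is hidden below [u]: by the plateau
    [l] on the rim of [E], where the obstacle is at most [d], and by [l + a] on
    the core, where it exceeds [d]. Elsewhere it is a subsolution. *)
Lemma spread d a l s : 0 < d -> 0 < a -> 0 <= l -> 0 <= s ->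
  (forall x t, E x -> s <= t -> l <= u (x, t)) ->
  (forall x t, eball x d `<=` E -> E x -> s <= t -> l + a <= u (x, t)) ->
  forall x t, s <= t -> 2 * d <= vt (x, t - s) -> l + a / 3 <= u (x, t).
Proof.
move=> d0 a0 l0 s0 Eu cu x t st vx.
pose B := a * (moebius_pole a d l + d); pose theta := moebius a d l.
have B0 : 0 < B by exact: moebius_gt0.
have p0 : 0 < moebius_pole a d l by exact: moebius_pole_gt0.
pose g z := vt (z.1, z.2 - s).
have cg : continuous (g : V * R -> R).
  move=> z; apply: (@continuous_comp _ _ _ (fun z : V * R => (z.1, z.2 - s)) vt).
    move=> P; rewrite !nbhs_simpl/= => /nbhs_boxP[e e0 He]; apply/nbhs_boxP.
    by exists e => // y y1 y2; apply: He => //=; rewrite opprB addrA subrK.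
  exact: (extension_continuous vE).
pose phi z := theta (Num.max 0 (g z)).
have M0 z : 0 <= Num.max 0 (g z) by rewrite le_max lexx.
have cphi : continuous (phi : V * R -> R).
  move=> z; rewrite /phi /theta /moebius; apply: cvgB; first exact: cvg_cst.
  apply: cvgMr; apply: cvgV; first by rewrite gt_eqF// ltr_wpDr.
  apply: cvgD; first exact: cvg_cst.
  apply: continuous_max; first exact: cvg_cst.
  exact: cg.
have key z : s <= z.2 -> u z < phi z -> 0 < g z /\ obstacle E z.1 < g z.
  move=> sz uphi; have z0 : 0 <= z.2 by exact: le_trans s0 sz.
  have g0 : 0 < g z.
    rewrite ltNge; apply/negP => gz; move: uphi; rewrite ltNge => /negP; apply.
    rewrite /phi max_l//; apply: le_trans (maximal_ge0 z0).
    exact: moebius0.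
  split=> //; rewrite ltNge; apply/negP => go.
  have Ez : E z.1.
    apply: contrapT => /obstacle_out_le0; rewrite leNgt => /negP; apply.
    exact: lt_le_trans g0 go.
  have uE : phi z = theta (g z) by rewrite /phi max_r// ltW.
  have [gd|gd] := leP (g z) d.
    have := Eu z.1 z.2 Ez sz; rewrite -surjective_pairing leNgt => /negP; apply.
    apply: lt_le_trans uphi _; rewrite uE -[leRHS](moebius_gap a0 d0 l0).
    by apply: moebius_mono => //; exact: ltW.
  have bE : eball z.1 d `<=` E.
    by apply: obstacle_ball (ltW d0) _; exact: lt_le_trans gd go.
  have := cu z.1 z.2 bE Ez sz; rewrite -surjective_pairing leNgt => /negP; apply.
  apply: lt_trans uphi _; rewrite uE; apply: moebius_lt => //; exact: ltW.
pose C : set (V * R) := [set z | s <= z.2].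
pose D : set (V * R) := [set z | s < z.2] `&` [set z | 0 < phi z].
have W : is_subsolution f (fun=> 0) (gluemax C u phi).
  apply: (@gluemax_subsolution _ _ _ _ _ _ C D maximal_sub) => //.
  - have -> : C = snd @^-1` [set r : R | s <= r] by [].
    by apply: preimage_closed; [move=> z _; exact: cvg_snd|exact: closed_ge].
  - apply: openI.
      have -> : [set z : V * R | s < z.2] = snd @^-1` [set r : R | s < r] by [].
      by apply: open_comp; [move=> z _; exact: cvg_snd|exact: open_gt].
    have -> : [set z : V * R | 0 < phi z] = phi @^-1` [set r : R | 0 < r] by [].
    by apply: open_comp; [move=> z _; exact: cphi|exact: open_gt].
  - by move=> z [/ltW].
  - move=> z Cz z0 uphi; split; last by apply: le_lt_trans uphi; exact: maximal_ge0.
    rewrite /= lt_neqAle Cz andbT; apply/negP => /eqP sz.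
    have [_] := key z Cz uphi; rewrite /g (extension_neg vE) ?ltxx//=.
    by rewrite sz subrr.
  - by move=> z [/(le_lt_trans s0)].
  - move=> z p X t' [sz phi0] uphi jphi.
    have [g0 og] := key z (ltW sz) uphi.
    have mE : Num.max 0 (g z) = g z by rewrite max_r// ltW.
    pose b := l + a - phi z.
    have b0 : 0 < b by rewrite subr_gt0; apply: moebius_lt.
    have bE (y : V * R) : b - (phi y - phi z) = l + a - phi y by rewrite opprB addrA subrK.
    have Bb (y : V * R) : B / (l + a - phi y) = moebius_pole a d l + Num.max 0 (g y).
      exact: moebius_inv.
    pose k := B / b ^+ 2; pose m := 2 * B / b ^+ 3.
    have k0 : 0 < k by rewrite divr_gt0// exprn_gt0.
    have jg : superjet (EFin \o g) z (k *: p) (k *: X + m *: (p^T *m p)) (k * t').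
      apply: (@superjet_chain _ _ _ phi z p X t' (fun q => B / (b - q) - B / b)
        k m (2 * B / b ^+ 4) (b / 2)) => //.
      - exact: ltW.
      - by rewrite ltW// divr_gt0 ?exprn_gt0// pmulr_rgt0.
      - by rewrite ltW// divr_gt0 ?exprn_gt0// pmulr_rgt0.
      - by rewrite divr_gt0.
      - move=> q q' qq' q'b; rewrite lerD2r ler_pM2l// lef_pV2 ?posrE; lra.
      - by move=> q qb; exact: inverse_taylor_le.
      - apply: near_all => y; rewrite /= lee_fin bE !Bb mE.
        have : g y <= Num.max 0 (g y) by rewrite le_max lexx orbT.
        lra.
    have sz0 : 0 < z.2 - s by rewrite subr_gt0.
    have := extension_superjet vE (z := (z.1, z.2 - s)) sz0 og (superjet_translate_time jg).
    move=> H; apply: (@le_trans _ _ 0%E); last exact: source_env_ge0 source_ge0 _.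
    rewrite leNgt; apply/negP => tH.
    have [h hH th] : exists2 h : R, (h%:E <= Hlow p X)%E & 0 < t' + h.
      case: (Hlow p X) tH => [r| |]//; first by rewrite -EFinD lte_fin => ?; exists r.
      by move=> _; exists (1 - t'); rewrite ?leey//; lra.
    have := le_trans (leeD2l _ (Hlow_geometric m k0 hH)) H.
    by rewrite -EFinD lee_fin -mulrDr leNgt mulr_gt0.
have cW : compactly_supported (gluemax C u phi).
  move=> T T0; have [ru ru0 Hu] := maximal_supp T0.
  have [rv rv0 Hv] := extension_support cE vE T0.
  exists (Num.max ru rv) => [|y t' ny tT]; first by rewrite lt_max ru0.
  have [yu yv] : ru <= enorm y /\ rv <= enorm y.
    by move: ny; rewrite /eball/= subr0 => /negP; rewrite -leNgt ge_max => /andP.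
  have uy : u (y, t') = 0 by apply: Hu tT; rewrite /eball/= subr0 ltNge yu.
  rewrite /gluemax; case: asboolP => //= st'; rewrite uy.
  apply/eqP; rewrite eq_le le_max lexx andbT ge_max lexx/=.
  have vy : g (y, t') <= 0.
    apply: Hv => //=; rewrite subr_ge0 st'/=; have /andP[_] := tT.
    by rewrite lerBlDr => /le_trans; apply; rewrite lerDl.
  by rewrite /phi max_l//; exact: moebius0.
have t0 : 0 <= t by exact: le_trans st.
have := @maximal_ge _ W cW (x, t) t0; apply: le_trans.
apply: le_trans (gluemax_ger u phi (st : C (x, t))).
apply: le_trans (moebius_2gap a0 d0 l0) _; apply: moebius_mono => //.
  by rewrite mulr_ge0// ltW.
by rewrite le_max vx orbT.
Qed.

(** A period consists of a unit of time for [birth] and of [T] for [spread]; as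
    the region reached contains [E], the next period can start there. *)
Lemma staircase d a T : 0 < d -> 0 < a -> a * (1 + 8 * n%:R / d ^+ 2) <= c -> 0 < T ->
  (forall x, E x -> 2 * d < vt (x, T)) ->
  forall (k : nat) x t, 2 * d < vt (x, T) -> k%:R * (T + 1) <= t -> k%:R * (a / 3) <= u (x, t).
Proof.
move=> d0 a0 ac T0 ET; elim=> [|k IH] x t vx kt.
  by rewrite mul0r maximal_ge0//; move: kt; rewrite mul0r.
have k0 : 0 <= k%:R * (T + 1) by rewrite mulr_ge0// addr_ge0// ltW.
have kt' : k%:R * (T + 1) + 1 <= t - T by move: kt; rewrite -natr1; lra.
have -> : k.+1%:R * (a / 3) = k%:R * (a / 3) + a / 3 by rewrite -natr1; ring.
apply: (@spread d a (k%:R * (a / 3)) (t - T)) => //.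
- by rewrite mulr_ge0// divr_ge0// ltW.
- by lra.
- by move=> y t' Ey tt'; apply: IH; [exact: ET|lra].
- move=> y t' yE Ey tt'; apply: (@birth d a (k%:R * (a / 3)) (k%:R * (T + 1))) => //.
    by move=> y' t'' Ey' tt''; apply: IH => //; exact: ET.
  by apply: le_trans tt'.
- by rewrite lerBlDr lerDl ltW.
- by rewrite subKr ltW.
Qed.

End Growth.

Section Front.
Context {R : realType} {n : nat}.
Local Notation V := 'rV[R]_n.
Implicit Types (E K : set V).

(** An empty front cannot fill space, so the default value was not chosen. *)
Lemma front_obstacle_solution E : front_fills_space E ->
  is_obstacle_solution E (obstacle_solution E).
Proof.
move=> EF; apply: xgetPex; apply: contrapT => noSol.
have : compact [set (0 : V)] by exact: compact_set1.
move=> /EF [t0 [_ /(_ (t0 + 1))]]; rewrite ltrDl ltr01 => /(_ isT 0 erefl).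
rewrite /front/= /obstacle_solution; case: xgetP => [w _ wS _|_]; last by rewrite ltxx.
by apply: noSol; exists w.
Qed.

(** A positive continuous function on a compact set is bounded below, so that
    level [0] of the front can be traded for level [2 * d]. *)
Lemma front_margin E K : compact K -> front_fills_space E ->
  exists d T : R, [/\ 0 < d, 0 < T & forall x, K x ->
    2 * d < extension (obstacle_solution E) (x, T)].
Proof.
move=> cK EF; have vE := front_obstacle_solution EF.
set w := extension _.
have [T T0 KT] : exists2 T : R, 0 < T & K `<=` front E T.
  have [t0 [_ H]] := EF K cK; exists (`|t0| + 1); first by rewrite ltr_wpDl.
  by apply: H; apply: le_lt_trans (ler_norm _) _; rewrite ltrDl.
have wK x : K x -> 0 < w (x, T).
  by move=> /KT; rewrite /w extension_id//=; exact: ltW.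
have [[x0 Kx0]|K0] := pselect (exists x, K x); last first.
  by exists 1, T; split=> // x Kx; exfalso; apply: K0; exists x.
have cw : continuous (fun x : V => w (x, T)).
  move=> x P /(@extension_continuous _ _ _ _ vE (x, T)); rewrite !nbhs_simpl/= => /nbhs_boxP[e e0 He].
  by apply/nbhs_eballP; exists e => // y yx; apply: He => //=; rewrite subrr normr0.
have uw : usc_on K (fun x : V => (0%:E - (w (x, T))%:E)%E).
  apply: (@usc_onB _ _ K (fun=> 0%:E)); last by move=> x _; exact: cw.
  by move=> x b _ b0; exact: near_all.
have [x1 Kx1 x1max] := usc_compact_max cK Kx0 uw.
exists (w (x1, T) / 3), T; split=> //; first by rewrite divr_gt0// wK.
move=> x Kx; have := x1max x Kx; rewrite -!EFinB !sub0r lee_fin lerN2.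
by have := wK _ Kx1; lra.
Qed.

End Front.

Unset Implicit Arguments.

Theorem theorem5p6 (R : realType) (n : nat) (n_gt0 : (0 < n)%N)
    (c : R) (c_gt0 : 0 < c)
    (E : set 'rV[R]_n) (cE : compact E)
    (u : 'rV[R]_n * R -> R)
    (u_max : is_maximal_solution (fun x => c * \1_E x) (fun=> 0) u)
    (E_fills : front_fills_space E)
    (r : R) (r_ge : n%:R <= r) :
  let U (t : R) : \bar R :=
    ereal_inf [set lsc_env spacetime u (x, t) |
                 x in closure (eball 0 r) `|` E] in
  exists a t1 : R,
    [/\ 0 < a, 0 < t1,
        forall t, 0 <= t -> ((a * (t - t1))%:E <= U t)%E
      & (a%:E <= limf_einf (fun t : R =>
            ereal_inf [set lsc_env spacetime u (x, t) * (t^-1)%:E |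
                         x in eball 0%R r]) (pinfty_nbhs R))%E].
Proof.
move=> U; have vE := front_obstacle_solution E_fills.
have cK : compact (closure (eball (0 : 'rV[R]_n) r) `|` E).
  apply: compactU => //; apply: bounded_closed_compact; last exact: closed_closure.
  exists r; split; first exact: num_real.
  move=> M rM y /(_ (ball y (M - r))) [].
    by apply: nbhsx_ballx; rewrite subr_gt0.
  move=> x []; rewrite /eball/= subr0 mx_norm_ball /ball_/= => xr yx.
  rewrite -[y](subrK x) (le_trans (ler_normD _ _))//.
  by have := mx_norm_le_enorm x; lra.
have [d [T [d0 T0 Kd]]] := front_margin cK E_fills.
have [a [a0 ac]] : exists a : R, 0 < a /\ a * (1 + 8 * n%:R / d ^+ 2) <= c.
  have p0 : 0 < 1 + 8 * n%:R / d ^+ 2.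
    by apply: ltr_wpDr => //; apply: divr_ge0; [exact: mulr_ge0|exact: sqr_ge0].
  by exists (c / (1 + 8 * n%:R / d ^+ 2)); rewrite divr_gt0// divfK// gt_eqF.
have S0 : 0 < T + 1 by rewrite addr_gt0.
have stair := staircase n_gt0 c_gt0 cE u_max vE d0 a0 ac T0 (fun x Ex => Kd x (or_intror Ex)).
have u0 := maximal_ge0 n_gt0 c_gt0 cE u_max.
pose A := a / 3 / (T + 1); have A0 : 0 < A by rewrite !divr_gt0.
have low x t : (closure (eball 0 r) `|` E) x -> 0 <= t ->
    ((A * (t - 2 * (T + 1)))%:E <= lsc_env spacetime u (x, t))%E.
  move=> Kx t0; have [tT|tT] := leP t (2 * (T + 1)).
    apply: (@le_trans _ _ 0%E).
      by rewrite lee_fin pmulr_rle0// subr_le0.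
    by apply: lsc_env_ge; apply: near_all => z z0; rewrite lee_fin u0.
  (* one period less than have elapsed, so that [t] is interior to the estimate *)
  have [k kt tk] : exists2 k : nat, k%:R * (T + 1) < t & t <= (k%:R + 2) * (T + 1).
    have tS : 0 <= t / (T + 1) by rewrite divr_ge0// ltW.
    have /andP[h1 h2] := truncn_itv tS.
    move: h1 h2; case: (Num.truncn _) => [|j].
      by rewrite ltr_pdivrMr// => _ h; exfalso; move: h tT; rewrite mul1r; lra.
    rewrite ler_pdivlMr// ltr_pdivrMr// -!natr1 => h1 h2; exists j.
      by apply: lt_le_trans h1; rewrite ltr_pM2r// ltrDl.
    by apply: ltW; apply: lt_le_trans h2 _; rewrite ler_pM2r//; lra.
  have nx : nbhs (x, t) [set z | 2 * d < extension (obstacle_solution E) (z.1, T)].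
    have : nbhs (extension (obstacle_solution E) (x, T)) [set s | 2 * d < s].
      by apply: open_nbhs_nbhs; split; [exact: open_gt|exact: Kd].
    move=> /(extension_continuous vE); rewrite nbhs_simpl/= => /nbhs_boxP[e e0 He].
    apply/nbhs_boxP; exists e => // z z1 _; apply: He => //=.
    by rewrite subrr normr0.
  have nt : nbhs (x, t) [set z : 'rV[R]_n * R | k%:R * (T + 1) < z.2].
    apply/nbhs_boxP; exists (t - k%:R * (T + 1)); first by rewrite subr_gt0.
    by move=> z _ /=; rewrite ltr_norml => /andP[+ _]; lra.
  apply: lsc_env_ge; apply: filterS2 nx nt => -[y s] /= ys ks _.
  rewrite lee_fin; apply: le_trans (stair k y s ys (ltW ks)).
  rewrite /A mulrAC ler_pdivrMr//.
  have a3 : 0 <= a / 3 by rewrite divr_ge0// ltW.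
  by have := ler_wpM2l a3 tk; lra.
exists A, (2 * (T + 1)); split=> //.
- by rewrite mulr_gt0.
- by move=> t t0; apply: le_ereal_inf_tmp => _ [x Kx <-]; exact: low.
- apply: lee_fin_subP => e e0; rewrite limf_einfE.
  pose M := Num.max 1 (A * (2 * (T + 1)) / e).
  apply: le_trans (ereal_sup_ubound _); last first.
    by exists [set t | M < t] => //; exists M; split=> //; exact: num_real.
  apply: le_ereal_inf_tmp => _ [t /= Mt <-].
  have t1 : 1 < t by apply: le_lt_trans Mt; rewrite le_max lexx.
  have te : A * (2 * (T + 1)) < e * t.
    by rewrite [ltRHS]mulrC -ltr_pdivrMr//; apply: le_lt_trans Mt; rewrite le_max lexx orbT.
  have t0 : 0 < t by apply: lt_trans t1.
  apply: le_ereal_inf_tmp => _ [x xr <-].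
  have Kx : (closure (eball 0 r) `|` E) x by left; exact: subset_closure.
  apply: (@le_trans _ _ ((A * (t - 2 * (T + 1)))%:E * (t^-1)%:E)%E); last first.
    by apply: lee_wpmul2r; [rewrite lee_fin invr_ge0 ltW|apply: low => //; exact: ltW].
  by rewrite -EFinM lee_fin ler_pdivlMr//; move: te; lra.
Qed.
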